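(* For every $m,n\in\mathbb Z_+$ the map $\varphi_{m,n}\colon\mathbbm k\mathcal F(x_1,\dots,x_m)^{\otimes n}\to\mathcal P_{\mathbf{CocHopf}}(\mathbbm k)(m,n)$ is a linear bijection. Moreover, if $\mathcal F(x_1,x_2,\dots)$ is the free group of countable rank, then the (multilinear) polynomial identities with coefficients in $\mathbbm k$ of the group Hopf algebra $\mathbbm k\mathcal F(x_1,x_2,\dots)$ are generated by $V_{\mathbf{CocHopf}}$, i.e. (over the Hopf algebra axioms) by the cocommutativity identity $x_{(1)}\otimes x_{(2)}-x_{(2)}\otimes x_{(1)}\equiv0$.
   Context: $\mathbbm k$ is a field. Let $\Omega=\{\mu,u,\Delta,\varepsilon,S\}$ with $(s,t)$ equal to $(2,1),(0,1),(1,2),(1,0),(1,1)$ respectively. $\mathcal M(\Omega)$ is the free braided strict monoidal category on one object $1$ and morphisms $\omega\colon1^{\otimes s(\omega)}\to1^{\otimes t(\omega)}$ (objects $\mathbb Z_+$, $m\otimes n=m+n$, morphisms generated by identities, braidings $\tau_{m,n}$, their inverses and the $\omega$'s modulo the relations of a braided strict monoidal category); $\mathcal P(\mathbbm k,\Omega)(m,n)$ is the vector space with basis $\mathcal M(\Omega)(m,n)$. For a set $V\subseteq\mathcal P(\mathbbm k,\Omega)$, $\mathcal P_V(\mathbbm k,\Omega)$ is the quotient by the smallest monoidal ideal (subspaces of hom-spaces closed under composition on both sides and $\otimes$ with arbitrary morphisms) containing $V$. Every Hopf algebra $H$ is an $\Omega$-algebra and $\mathcal E_H\colon\mathcal P(\mathbbm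 k,\Omega)\to\mathbf{Vect}_{\mathbbm k}$ is the linear braided monoidal functor with $n\mapsto H^{\otimes n}$, $\omega\mapsto$ the corresponding structure map, $\tau_{m,n}\mapsto$ flip; $f\equiv0$ is a polynomial identity of $H$ if $\mathcal E_H(f)=0$, and $V$ generates the polynomial identities of $H$ if $\mathcal E_H$ vanishes on $V$ and every polynomial identity of $H$ has zero image in $\mathcal P_V(\mathbbm k,\Omega)$. $V_{\mathbf{Hopf}}$ consists of $\tau_{1,1}^2-\mathrm{id}_2$, $\mu(\mu\otimes\mathrm{id}_1)-\mu(\mathrm{id}_1\otimes\mu)$, $\mu(u\otimes\mathrm{id}_1)-\mathrm{id}_1$, $\mu(\mathrm{id}_1\otimes u)-\mathrm{id}_1$, $(\Delta\otimes\mathrm{id}_1)\Delta-(\mathrm{id}_1\otimes\Delta)\Delta$, $(\varepsilon\otimes\mathrm{id}_1)\Delta-\mathrm{id}_1$, $(\mathrm{id}_1\otimes\varepsilon)\Delta-\mathrm{id}_1$, $\varepsilon u-\mathrm{id}_0$, $\varepsilon\mu-\varepsilon\otimes\varepsilon$, $\Delta u-u\otimes u$, $\Delta\mu-(\mu\otimes\mu)(\mathrm{id}_1\otimes\tau_{1,1}\otimes\mathrm{id}_1)(\Delta\otimes\Delta)$, $\mu(S\otimes\mathrm{id}_1)\Delta-u\varepsilon$, $\mu(\mathrm{id}_1\otimes S)\Delta-u\varepsilon$. $V_{\mathbf{CocHopf}}:=V_{\mathbf{Hopf}}\cup\{\Delta-\tau_{1,1}\Delta\}$ and $\mathcal P_{\mathbf{CocHopf}}(\mathbbm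 k):=\mathcal P_{V_{\mathbf{CocHopf}}}(\mathbbm k,\Omega)$. Functional notation: in $\mathcal P_{\mathbf{CocHopf}}(\mathbbm k)(m,n)$ (which is symmetric since $\tau_{1,1}^2=\mathrm{id}_2$ holds), an expression in variables $x_1,\dots,x_m$ denotes the morphism that first applies to the $q$-th input $\varepsilon$ if $\varepsilon(x_q)$ is written, or the iterated comultiplication $(\Delta\otimes\mathrm{id}_{p-2})\cdots(\Delta\otimes\mathrm{id}_1)\Delta$ producing $x_{q(1)}\otimes\dots\otimes x_{q(p)}$ (with $x_{q(1)}:=x_q$ if $p=1$), then permutes tensor factors by symmetric braidings, applies $S$ where indicated, multiplies juxtaposed factors with $\mu$, and uses $u$ for an empty product. $\mathcal F(x_1,\dots,x_m)$ is the free group; its group algebra has the standard basis of tensors $w_1\otimes\dots\otimes w_n$ of group elements written as reduced words. $\varphi_{m,n}(w_1\otimes\dots\otimes w_n)$ is obtained by: replacing every letter $x_j^{-1}$ by $Sx_j$ (a power $x_j^{\pm k}$ being written as $k$ letters); if $x_j$ occurs (with either sign) more than once in total, replacing its $r$-th occurrence (counted left to right through $w_1,\dots,w_n$) by $x_{j(r)}$; if $x_j$ does not occur, prefixing the factor $\varepsilon(x_j)$; the tensor factor for $w_i=1$ is $u$. $\varphi_{m,n}$ is extended linearly. E.g. $\varphi_{5,2}(x_1x_2x_1^{-1}\otimes x_5x_2^{-1}x_1^2)=\varepsilon(x_3)\varepsilon(x_4)\,x_{1(1)}x_{2(1)}Sx_{1(2)}\otimes x_5(Sx_{2(2)})x_{1(3)}x_{1(4)}$.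 *)

(* Defs.v *)
From HB Require Import structures.
From mathcomp Require Import all_boot all_algebra.
Set Implicit Arguments. Unset Strict Implicit. Unset Printing Implicit Defensive.
Import GRing.Theory.
Local Open Scope ring_scope.

Inductive Om := oMu | oU | oDelta | oEps | oS.
Definition om_s (o : Om) : nat :=
  match o with oMu => 2 | oU => 0 | oDelta => 1 | oEps => 1 | oS => 1 end.
Definition om_t (o : Om) : nat :=
  match o with oMu => 1 | oU => 1 | oDelta => 2 | oEps => 0 | oS => 1 end.

(* ---------- Raw morphism terms of the free braided strict monoidal
   category M(Omega) on one object (objects are nat, m (x) n = m + n). ----
   TId n = id_n ; TBr m n = tau_{m,n} : m+n -> n+m ;
   TBrI m n = tau_{m,n}^{-1} : n+m -> m+n ; TGen o = o ;
   TComp f g = f o g ; TTens f g = f (x) g. *)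
Inductive Tm :=
| TId (n : nat)
| TBr (m n : nat)
| TBrI (m n : nat)
| TGen (o : Om)
| TComp (f g : Tm)
| TTens (f g : Tm).

Scheme Equality for Om.
Scheme Equality for Tm.

Fixpoint dom (t : Tm) : nat :=
  match t with
  | TId n => n | TBr m n => m + n | TBrI m n => n + m | TGen o => om_s o
  | TComp f g => dom g | TTens f g => dom f + dom g
  end.
Fixpoint cod (t : Tm) : nat :=
  match t with
  | TId n => n | TBr m n => n + m | TBrI m n => m + n | TGen o => om_t o
  | TComp f g => cod f | TTens f g => cod f + cod g
  end.
Fixpoint wt (t : Tm) : bool :=
  match t with
  | TComp f g => [&& wt f, wt g & cod g == dom f]
  | TTens f g => wt f && wt g
  | _ => true
  end.

Definition mu := TGen oMu.
Definition un := TGen oU.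
Definition De := TGen oDelta.
Definition ep := TGen oEps.
Definition An := TGen oS.

Section Comb.
Variable k : fieldType.

Definition coef (c : seq (k * Tm)) (t : Tm) : k :=
  \sum_(p <- c) (if Tm_eq_dec p.2 t then p.1 else 0).

Definition typed (m n : nat) (c : seq (k * Tm)) : bool :=
  all (fun p => [&& wt p.2, dom p.2 == m & cod p.2 == n]) c.

Definition rel (f g : Tm) : seq (k * Tm) := [:: (1, f); (-1, g)].
Definition scale (a : k) (c : seq (k * Tm)) : seq (k * Tm) :=
  [seq (a * p.1, p.2) | p <- c].

Inductive StructAx : nat -> nat -> seq (k * Tm) -> Prop :=
| ax_idl f : wt f -> StructAx (dom f) (cod f) (rel (TComp (TId (cod f)) f) f)
| ax_idr f : wt f -> StructAx (dom f) (cod f) (rel (TComp f (TId (dom f))) f)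
| ax_assoc f g h : wt f -> wt g -> wt h -> dom f = cod g -> dom g = cod h ->
    StructAx (dom h) (cod f) (rel (TComp (TComp f g) h) (TComp f (TComp g h)))
| ax_tassoc f g h : wt f -> wt g -> wt h ->
    StructAx (dom f + dom g + dom h) (cod f + cod g + cod h)
      (rel (TTens (TTens f g) h) (TTens f (TTens g h)))
| ax_tunitl f : wt f -> StructAx (dom f) (cod f) (rel (TTens (TId 0) f) f)
| ax_tunitr f : wt f -> StructAx (dom f) (cod f) (rel (TTens f (TId 0)) f)
| ax_tid m n : StructAx (m + n) (m + n) (rel (TTens (TId m) (TId n)) (TId (m + n)))
| ax_interchange f g f' g' : wt f -> wt g -> wt f' -> wt g' ->
    dom f = cod g -> dom f' = cod g' ->
    StructAx (dom g + dom g') (cod f + cod f')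
      (rel (TTens (TComp f g) (TComp f' g')) (TComp (TTens f f') (TTens g g')))
| ax_nat f g : wt f -> wt g ->
    StructAx (dom f + dom g) (cod g + cod f)
      (rel (TComp (TBr (cod f) (cod g)) (TTens f g))
           (TComp (TTens g f) (TBr (dom f) (dom g))))
| ax_hex1 m n p : StructAx (m + n + p) (n + p + m)
    (rel (TBr m (n + p)) (TComp (TTens (TId n) (TBr m p)) (TTens (TBr m n) (TId p))))
| ax_hex2 m n p : StructAx (m + n + p) (p + m + n)
    (rel (TBr (m + n) p) (TComp (TTens (TBr m p) (TId n)) (TTens (TId m) (TBr n p))))
| ax_inv1 m n : StructAx (m + n) (m + n) (rel (TComp (TBrI m n) (TBr m n)) (TId (m + n)))
| ax_inv2 m n : StructAx (n + m) (n + m) (rel (TComp (TBr m n) (TBrI m n)) (TId (n + m))).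

Inductive VCocHopf : nat -> nat -> seq (k * Tm) -> Prop :=
| v_sym : VCocHopf 2 2 (rel (TComp (TBr 1 1) (TBr 1 1)) (TId 2))
| v_assoc : VCocHopf 3 1 (rel (TComp mu (TTens mu (TId 1))) (TComp mu (TTens (TId 1) mu)))
| v_unitl : VCocHopf 1 1 (rel (TComp mu (TTens un (TId 1))) (TId 1))
| v_unitr : VCocHopf 1 1 (rel (TComp mu (TTens (TId 1) un)) (TId 1))
| v_coassoc : VCocHopf 1 3 (rel (TComp (TTens De (TId 1)) De) (TComp (TTens (TId 1) De) De))
| v_counitl : VCocHopf 1 1 (rel (TComp (TTens ep (TId 1)) De) (TId 1))
| v_counitr : VCocHopf 1 1 (rel (TComp (TTens (TId 1) ep) De) (TId 1))
| v_epu : VCocHopf 0 0 (rel (TComp ep un) (TId 0))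
| v_epmu : VCocHopf 2 0 (rel (TComp ep mu) (TTens ep ep))
| v_Deu : VCocHopf 0 2 (rel (TComp De un) (TTens un un))
| v_Demu : VCocHopf 2 2 (rel (TComp De mu)
     (TComp (TTens mu mu) (TComp (TTens (TId 1) (TTens (TBr 1 1) (TId 1))) (TTens De De))))
| v_antil : VCocHopf 1 1 (rel (TComp mu (TComp (TTens An (TId 1)) De)) (TComp un ep))
| v_antir : VCocHopf 1 1 (rel (TComp mu (TComp (TTens (TId 1) An) De)) (TComp un ep))
| v_cocomm : VCocHopf 1 2 (rel De (TComp (TBr 1 1) De)).

(* Ideal m n c  <->  the combination c (of terms m -> n) is zero in
   P_CocHopf(k)(m,n): the smallest family of subspaces of the free vector
   spaces on terms containing the braided-monoidal relations and V_CocHopf,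
   closed under composition and tensor with arbitrary morphisms. *)
Inductive Ideal : nat -> nat -> seq (k * Tm) -> Prop :=
| i_struct m n c : StructAx m n c -> Ideal m n c
| i_gen m n c : VCocHopf m n c -> Ideal m n c
| i_nil m n : Ideal m n [::]
| i_add m n c1 c2 : Ideal m n c1 -> Ideal m n c2 -> Ideal m n (c1 ++ c2)
| i_scale m n a c : Ideal m n c -> Ideal m n (scale a c)
| i_coef m n c c' : Ideal m n c -> typed m n c' ->
    (forall t, coef c t = coef c' t) -> Ideal m n c'
| i_compl m n t c : wt t -> dom t = n -> Ideal m n c ->
    Ideal m (cod t) [seq (p.1, TComp t p.2) | p <- c]
| i_compr m n t c : wt t -> cod t = m -> Ideal m n c ->
    Ideal (dom t) n [seq (p.1, TComp p.2 t) | p <- c]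
| i_tensl m n t c : wt t -> Ideal m n c ->
    Ideal (dom t + m) (cod t + n) [seq (p.1, TTens t p.2) | p <- c]
| i_tensr m n t c : wt t -> Ideal m n c ->
    Ideal (m + dom t) (n + cod t) [seq (p.1, TTens p.2 t) | p <- c].
End Comb.

(* ---------- Free groups: words in letters (j, b), meaning x_{j+1} if b = false
   and x_{j+1}^{-1} if b = true (0-based indices). ---------- *)
Definition W := seq (nat * bool).

Fixpoint reducedb (w : W) : bool :=
  match w with
  | a :: ((b :: _) as w') => ~~ ((a.1 == b.1) && (a.2 != b.2)) && reducedb w'
  | _ => true
  end.

(* standard basis of kF(x_1..x_m)^{(x) n}: n-tuples of reduced words *)
Definition basisF (m n : nat) (ws : seq W) : bool :=
  (size ws == n) && all (fun w => reducedb w && all (fun a => a.1 < m)%N w) ws.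

Definition validF (k : fieldType) (m n : nat) (a : seq (k * seq W)) : bool :=
  all (fun p => basisF m n p.2) a.

Definition coefF (k : fieldType) (a : seq (k * seq W)) (ws : seq W) : k :=
  \sum_(p <- a | p.2 == ws) p.1.

Fixpoint comul (p : nat) : Tm :=
  match p with
  | 0 => ep
  | S p' => match p' with
            | 0 => TId 1
            | S p'' => match p'' with
                       | 0 => De
                       | S q => TComp (TTens De (TId q.+1)) (comul p')
                       end
            end
  end.

Fixpoint mult (l : nat) : Tm :=
  match l with
  | 0 => un
  | S l' => match l' with
            | 0 => TId 1
            | S _ => TComp mu (TTens (mult l') (TId 1))
            end
  end.

Definition tensL (ts : seq Tm) : Tm := foldr TTens (TId 0) ts.

(* permutation of N wires built from braidings: target wire t receives
   source wire (nth t s). *)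
Fixpoint permtm (N : nat) (s : seq nat) : Tm :=
  match N, s with
  | S N', x :: s' =>
      TComp (TTens (TId 1) (permtm N' [seq (if (x < i)%N then i.-1 else i) | i <- s']))
            (TTens (TBr x 1) (TId (size s' - x)))
  | _, _ => TId 0
  end.

Definition phi_tm (m : nat) (ws : seq W) : Tm :=
  let occ := flatten ws in
  let cnt j := count (fun a => a.1 == j) occ in
  let D := tensL [seq comul (cnt j) | j <- iota 0 m] in
  let src t := let j := (nth (0%N, false) occ t).1 in
               (count (fun a => a.1 < j)%N occ + count (fun a => a.1 == j) (take t occ))%N in
  let P := permtm (size occ) [seq src t | t <- iota 0 (size occ)] in
  let M := tensL [seq TComp (mult (size w))
                        (tensL [seq (if a.2 then An else TId 1) | a <- w]) | w <- ws] in
  TComp M (TComp P D).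

Definition phiC (k : fieldType) (m : nat) (a : seq (k * seq W)) : seq (k * Tm) :=
  [seq (p.1, phi_tm m p.2) | p <- a].

Definition pushF (a : nat * bool) (w : W) : W :=
  match w with
  | b :: w' => if (a.1 == b.1) && (a.2 != b.2) then w' else a :: w
  | [::] => [:: a]
  end.
Definition mulF (u v : W) : W := foldr pushF v u.
Definition invF (w : W) : W := rev [seq (a.1, ~~ a.2) | a <- w].

(* E_H on a term, applied to a basis tensor g_1 (x) ... (x) g_m of kF^{(x) m}:
   for a group algebra all structure maps send basis tensors to basis tensors
   (mu(g(x)h)=gh, u=1, Delta g = g(x)g, eps g = 1, S g = g^{-1}, flips). *)
Fixpoint evalG (t : Tm) (g : seq W) : seq W :=
  match t with
  | TId _ => g
  | TBr m _ => drop m g ++ take m g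
  | TBrI _ n => drop n g ++ take n g
  | TGen o => match o with
              | oMu => [:: mulF (nth [::] g 0) (nth [::] g 1)]
              | oU => [:: [::]]
              | oDelta => [:: nth [::] g 0; nth [::] g 0]
              | oEps => [::]
              | oS => [:: invF (nth [::] g 0)]
              end
  | TComp f h => evalG f (evalG h g)
  | TTens f h => evalG f (take (dom f) g) ++ evalG h (drop (dom f) g)
  end.

(* c == 0 is a polynomial identity of kF(x_1,x_2,...): E_H(c) vanishes on every
   basis tensor, i.e. every output basis coefficient is 0. *)
Definition polyId (k : fieldType) (m n : nat) (c : seq (k * Tm)) : Prop :=
  forall g : seq W, size g = m -> all reducedb g ->
  forall h : seq W, \sum_(p <- c | evalG p.2 g == h) p.1 = 0 :> k.

(* Main.v *)
Require Import Defs.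
From HB Require Import structures.
From Stdlib Require Import Setoid Morphisms.
From mathcomp Require Import all_boot all_algebra.
From mathcomp Require Import ring zify.
Import GRing.Theory.
Set Implicit Arguments. Unset Strict Implicit. Unset Printing Implicit Defensive.
Local Open Scope ring_scope.

(** In the quotient category the generator is a cocommutative Hopf object, and the
    tensor powers of its comultiplication make the category cartesian: the pairing
    of f : m -> a and g : m -> b is (f (x) g) D_m.  Hom(m, 1) is then a group under
    convolution, so words act on the projections pr_0, ..., pr_{m-1} : m -> 1.  By
    induction on the raw term, t composed with the tuple of the words ws equals the
    tuple of the words evalG t ws; for ws the generators, whose tuple is the
    identity, this says that t is determined modulo the ideal by
    evalG t (x_1, ..., x_m).  Since evalG sends phi(ws) back to ws, every t is
    congruent to phi (evalG t (x_1, ..., x_m)), which gives surjectivity; the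
    soundness of evalG for the ideal gives injectivity, and both together show that
    every identity of the free group algebra lies in the ideal. *)

(** * Coefficients and typing of formal linear combinations *)

Lemma coef_cons (k : fieldType) (p : k * Tm) c t :
  coef (p :: c) t = (if Tm_eq_dec p.2 t then p.1 else 0) + coef c t.
Proof. by rewrite /coef big_cons. Qed.

Lemma coef_nil (k : fieldType) t : coef (k := k) [::] t = 0.
Proof. by rewrite /coef big_nil. Qed.

Lemma coef_cat (k : fieldType) (c c' : seq (k * Tm)) t :
  coef (c ++ c') t = coef c t + coef c' t.
Proof. by rewrite /coef big_cat. Qed.

Lemma coef_scale (k : fieldType) a (c : seq (k * Tm)) t :
  coef (scale a c) t = a * coef c t.
Proof.
rewrite /coef /scale big_map mulr_sumr; apply: eq_bigr => p _ /=.
by case: Tm_eq_dec => //=; rewrite mulr0.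
Qed.

Lemma coef_rel (k : fieldType) f g t :
  coef (Defs.rel k f g) t =
  (if Tm_eq_dec f t then 1 else 0) - (if Tm_eq_dec g t then 1 else 0).
Proof.
by rewrite !coef_cons coef_nil addr0 /=; case: (Tm_eq_dec g t) => _ /=; rewrite ?oppr0.
Qed.

Lemma typed_rel (k : fieldType) m n f g :
  typed m n (Defs.rel k f g) =
  [&& wt f, dom f == m, cod f == n, wt g, dom g == m & cod g == n].
Proof. by rewrite /typed /= andbT -!andbA. Qed.

(** * Inverses of words and lengths of evaluated tuples *)

Local Notation invF := Defs.invF.

Lemma pushF_cancel a w : pushF (a.1, ~~ a.2) (a :: w) = w.
Proof. by rewrite /= eqxx; case: a.2. Qed.

Lemma mulF_rcons u a v : mulF (rcons u a) v = mulF u (pushF a v).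
Proof. by rewrite /mulF -cats1 foldr_cat. Qed.

Lemma invF_cons a w : invF (a :: w) = rcons (invF w) (a.1, ~~ a.2).
Proof. by rewrite /invF /= rev_cons. Qed.

(** The last letter of [invF (a :: w)] is pushed first and meets its inverse [a], so the words
    cancel from the middle outwards. *)
Lemma mulVF w : mulF (invF w) w = [::].
Proof. by elim: w => //= a w IH; rewrite invF_cons mulF_rcons pushF_cancel. Qed.

Lemma invFK : involutive invF.
Proof.
move=> w; rewrite /invF map_rev revK -map_comp -[RHS]map_id.
by apply: eq_map => -[j b] /=; rewrite negbK.
Qed.

Lemma mulFV w : mulF w (invF w) = [::].
Proof. by rewrite -{1}(invFK w) mulVF. Qed.

Lemma size_evalG t g : wt t -> size g = dom t -> size (evalG t g) = cod t.
Proof.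
elim: t g => [n|a b|a b|[]|f IHf h IHh|f IHf h IHh] g //=.
- by move=> _ sz; rewrite size_cat size_drop size_takel sz ?addKn // leq_addr.
- by move=> _ sz; rewrite size_cat size_drop size_takel sz ?addKn // leq_addr.
- by case/and3P=> wf wh /eqP e sz; apply: IHf => //; rewrite IHh.
case/andP=> wf wh sz; rewrite size_cat IHf ?IHh //.
  by rewrite size_drop sz addKn.
by rewrite size_takel // sz leq_addr.
Qed.

(** * Raw terms modulo the ideal as a strict symmetric monoidal category *)

Section Congruence.
Variable k : fieldType.

(* Requiring equal well-typedness, domains and codomains of all raw terms makes eqv
   a congruence without typing side conditions, as setoid rewriting needs. *)
Definition eqv (f g : Tm) : Prop :=
  [/\ wt f = wt g, dom f = dom g, cod f = cod g &
      wt f -> Ideal (dom f) (cod f) (Defs.rel k f g)].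

Local Notation "f ≈ g" := (eqv f g) (at level 70).
Local Notation "f ∘ g" := (TComp f g) (at level 40, left associativity).
Local Notation "f ⊗ g" := (TTens f g) (at level 35, right associativity).
Local Notation "'𝟙' n" := (TId n) (at level 9, n at level 8).

Lemma eqv_refl f : f ≈ f.
Proof.
split=> // wf; apply: (i_coef (i_nil k _ _)); first by rewrite typed_rel wf !eqxx.
by move=> t; rewrite coef_nil coef_rel subrr.
Qed.

#[local] Hint Resolve eqv_refl : core.

Lemma eqv_sym f g : f ≈ g -> g ≈ f.
Proof.
move=> [w d c H]; split=> // wg; rewrite -d -c.
apply: (i_coef (i_scale (-1) (H _))); rewrite ?w // ?typed_rel ?w ?wg ?d ?c ?eqxx //.
by move=> t; rewrite coef_scale !coef_rel mulN1r opprB.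
Qed.

Lemma eqv_trans f g h : f ≈ g -> g ≈ h -> f ≈ h.
Proof.
move=> [w d c H] [w' d' c' H']; split; rewrite ?w ?d ?c // => wg.
rewrite w d c in H; apply: (i_coef (i_add (H wg) (H' wg))).
  by rewrite typed_rel w -w' wg d c -d' -c' !eqxx.
by move=> t; rewrite coef_cat !coef_rel addrA subrK.
Qed.

#[local] Instance eqv_Equivalence : Equivalence eqv.
Proof. split; [exact: eqv_refl|exact: eqv_sym|exact: eqv_trans]. Qed.

(** Telescoping: fg - f'g' = (f - f')g + f'(g - g'), and the ideal absorbs composition on either
    side. The same splitting serves the tensor product. *)
#[local] Instance TComp_Proper : Proper (eqv ==> eqv ==> eqv) TComp.
Proof.
move=> f f' [w d c H] g g' [w' d' c' H'].
split=> //=; first by rewrite w w' c' d.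
case/and3P=> wf wg e.
have I1 := i_compr wg (eqP e) (H wf); have I2 := i_compl (t := f') _ _ (H' wg).
rewrite /= -w -d -(eqP e) -c in I2.
apply: (i_coef (i_add I1 (I2 wf erefl))).
  by rewrite typed_rel /= -w -w' -c -c' -d -d' wf wg e !eqxx.
by move=> t; rewrite coef_cat !coef_rel addrA subrK.
Qed.

#[local] Instance TTens_Proper : Proper (eqv ==> eqv ==> eqv) TTens.
Proof.
move=> f f' [w d c H] g g' [w' d' c' H'].
split=> //=; rewrite ?w ?w' ?d ?d' ?c ?c' //.
case/andP=> wf wg.
have := i_tensr (t := g) (eq_trans w' wg) (H (eq_trans w wf)).
have := i_tensl wf (H' (eq_trans w' wg)).
rewrite /= d d' c c' => I2 I1.
apply: (i_coef (i_add I1 I2)).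
  by rewrite typed_rel /= w w' wf wg d d' c c' !eqxx.
by move=> t; rewrite coef_cat !coef_rel addrA subrK.
Qed.

Lemma compA f g h : (f ∘ g) ∘ h ≈ f ∘ (g ∘ h).
Proof.
split=> //=; first by case: (wt f); case: (wt g); case: (wt h); rewrite /= ?andbF ?andbT // andbC.
case/and3P=> /and3P[wf wg e] wh e'.
by apply/i_struct/ax_assoc => //; apply/esym/eqP.
Qed.

Lemma comp_idl n f : cod f = n -> 𝟙 n ∘ f ≈ f.
Proof.
move=> <-; split=> //=; first by rewrite eqxx andbT.
by case/andP=> wf _; apply/i_struct/ax_idl.
Qed.

Lemma comp_idr n f : dom f = n -> f ∘ 𝟙 n ≈ f.
Proof.
move=> <-; split=> //=; first by rewrite eqxx andbT.
by case/andP=> wf _; apply/i_struct/ax_idr.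
Qed.

Lemma tensA f g h : (f ⊗ g) ⊗ h ≈ f ⊗ (g ⊗ h).
Proof.
split=> //=; rewrite ?andbA ?addnA // -andbA => /and3P[wf wg wh].
exact/i_struct/ax_tassoc.
Qed.

Lemma tens0l f : 𝟙 0 ⊗ f ≈ f.
Proof. by split=> //= wf; apply/i_struct/ax_tunitl. Qed.

Lemma tens0r f : f ⊗ 𝟙 0 ≈ f.
Proof.
split=> //=; rewrite ?andbT ?addn0 // => wf.
exact/i_struct/ax_tunitr.
Qed.

Lemma tens_id m n : 𝟙 m ⊗ 𝟙 n ≈ 𝟙 (m + n).
Proof. by split=> //= _; apply/i_struct/ax_tid. Qed.

(** Given [cod g = dom f], typing of the left side forces [cod g' = dom f'], so both sides have the
    same [wt], as [eqv] demands. *)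
Lemma tens_comp f g f' g' : cod g = dom f ->
  (f ⊗ f') ∘ (g ⊗ g') ≈ (f ∘ g) ⊗ (f' ∘ g').
Proof.
move=> e; symmetry; split=> //=.
  rewrite e eqxx eqn_add2l andbT.
  by case: (wt f); case: (wt g); case: (wt f'); case: (wt g').
case/andP=> /and3P[wf wg _] /and3P[wf' wg' e'].
by apply/i_struct/ax_interchange => //; apply/esym/eqP; rewrite -?e // eq_sym.
Qed.

Lemma br_nat a b c d f g : cod f = a -> cod g = b -> dom f = c -> dom g = d ->
  TBr a b ∘ (f ⊗ g) ≈ (g ⊗ f) ∘ TBr c d.
Proof.
move=> <- <- <- <-; split=> //=; first by rewrite !eqxx andbT andbT andbC.
by case/andP=> /andP[wf wg] _; apply/i_struct/ax_nat.
Qed.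

Lemma br_hexl m n p : TBr m (n + p) ≈ (𝟙 n ⊗ TBr m p) ∘ (TBr m n ⊗ 𝟙 p).
Proof.
split=> /=; rewrite ?addnA ?eqxx // => _.
exact/i_struct/ax_hex1.
Qed.

Lemma br_hexr m n p : TBr (m + n) p ≈ (TBr m p ⊗ 𝟙 n) ∘ (𝟙 m ⊗ TBr n p).
Proof. by split=> /=; rewrite ?addnA ?eqxx // => _; apply/i_struct/ax_hex2. Qed.

Lemma brI_l m n : TBrI m n ∘ TBr m n ≈ 𝟙 (m + n).
Proof. by split=> //=; rewrite ?eqxx // => _; apply/i_struct/ax_inv1. Qed.

Lemma eqv_gen m n f g : VCocHopf m n (Defs.rel k f g) ->
  wt f -> wt g -> dom f = dom g -> cod f = cod g -> dom f = m -> cod f = n -> f ≈ g.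
Proof.
move=> V wf wg d c dm cn; split=> //; first by rewrite wf wg.
by move=> _; rewrite dm cn; apply: i_gen.
Qed.

(** Side conditions of rewriting are equations between computed domains and codomains, hence linear
    arithmetic. The tactic is extended whenever new terms get known types. *)
Ltac tc := rewrite /=; lia.
Tactic Notation "rw" uconstr(L) := rewrite -> L by tc.
Tactic Notation "rwr" uconstr(L) := rewrite <- L by tc.

(** The hexagon makes this braiding idempotent, and an invertible idempotent is an identity. *)
Lemma br0n n : TBr 0 n ≈ 𝟙 n.
Proof.
have e : TBr 0 n ≈ TBr 0 n ∘ TBr 0 n.
  have := br_hexr 0 0 n; rewrite tens0l tens0r //.
have := brI_l 0 n; rewrite {1}e -compA brI_l => <-.
by rw comp_idl.
Qed.

Lemma brn0 n : TBr n 0 ≈ 𝟙 n.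
Proof.
have e : TBr n 0 ≈ TBr n 0 ∘ TBr n 0.
  have := br_hexl n 0 0; rewrite tens0l tens0r //.
have := brI_l n 0; rewrite {1}e -compA brI_l addn0 => <-.
by rw comp_idl.
Qed.

Lemma br11K : TBr 1 1 ∘ TBr 1 1 ≈ 𝟙 2.
Proof. exact: eqv_gen (v_sym k) _ _ _ _ _ _. Qed.

(** Symmetry is imposed only on [TBr 1 1]; the hexagons peel off one strand at a time and reduce the
    claim to that case. *)
Lemma br1nK m : TBr m 1 ∘ TBr 1 m ≈ 𝟙 (1 + m).
Proof.
elim: m => [|m IH]; first by rewrite br0n brn0; rw comp_idl.
rewrite -(add1n m) (br_hexl 1 1 m) (br_hexr 1 m 1).
rewrite compA -(compA (𝟙 1 ⊗ _)).
rw tens_comp; rewrite IH; rw comp_idl; rewrite -tens_id -tensA tens_id.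
rw tens_id; rw comp_idl; rw tens_comp; rewrite br11K.
rw comp_idl; by rewrite !tens_id.
Qed.

(** * The cartesian structure *)

(** The middle interchange from a + b + c + d to a + c + b + d, which builds the (co)multiplication
    of a tensor product from those of its factors. *)
Definition mid a b c d := 𝟙 a ⊗ (TBr b c ⊗ 𝟙 d).

Lemma mid_nat a b c d a' b' c' d' f1 f2 g1 g2 :
  dom f1 = a -> dom f2 = b -> dom g1 = c -> dom g2 = d ->
  cod f1 = a' -> cod f2 = b' -> cod g1 = c' -> cod g2 = d' ->
  mid a' b' c' d' ∘ ((f1 ⊗ f2) ⊗ (g1 ⊗ g2)) ≈ ((f1 ⊗ g1) ⊗ (f2 ⊗ g2)) ∘ mid a b c d.
Proof.
move=> *; rewrite /mid !tensA -(tensA f2) -(tensA g1).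
rw tens_comp; rw tens_comp; rw tens_comp; rw tens_comp.
rw comp_idl; rw comp_idl; rw comp_idr; rw comp_idr.
by rewrite -> (br_nat (c := b) (d := c)) by tc.
Qed.

Lemma mid_b0 a c d : mid a 0 c d ≈ 𝟙 (a + c + d).
Proof. by rewrite /mid br0n !tens_id addnA. Qed.

Lemma mid_c0 a b d : mid a b 0 d ≈ 𝟙 (a + b + d).
Proof. by rewrite /mid brn0 !tens_id addnA. Qed.

Lemma tens_compl a f g : 𝟙 a ⊗ (f ∘ g) ≈ (𝟙 a ⊗ f) ∘ (𝟙 a ⊗ g).
Proof. rw tens_comp; by rw comp_idl. Qed.

Lemma tens_compr a f g : cod g = dom f -> (f ∘ g) ⊗ 𝟙 a ≈ (f ⊗ 𝟙 a) ∘ (g ⊗ 𝟙 a).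
Proof. move=> e; rw tens_comp; by rw (comp_idl (n := a)). Qed.

Lemma exchange a b c d f g : dom f = a -> cod f = b -> dom g = c -> cod g = d ->
  (f ⊗ 𝟙 d) ∘ (𝟙 a ⊗ g) ≈ (𝟙 b ⊗ g) ∘ (f ⊗ 𝟙 c).
Proof.
move=> *; rw tens_comp; rw tens_comp.
rw comp_idl; rw comp_idr; rw comp_idl; by rw comp_idr.
Qed.

(* Both sides move the strands a a a b b b to a b a b a b. *)
Lemma mid_coassoc a b :
  (mid a a b b ⊗ 𝟙 (a + b)) ∘ mid (a + a) a (b + b) b ≈
  (𝟙 (a + b) ⊗ mid a a b b) ∘ mid a (a + a) b (b + b).
Proof.
have L1 : mid a a b b ⊗ 𝟙 (a + b) ≈ 𝟙 a ⊗ ((TBr a b ⊗ 𝟙 (b + a)) ⊗ 𝟙 b).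
  by rewrite /mid -!tens_id !tensA.
have L2 : mid (a + a) a (b + b) b ≈ 𝟙 a ⊗ ((𝟙 a ⊗ TBr a (b + b)) ⊗ 𝟙 b).
  by rewrite /mid -!tens_id !tensA.
have R1 : 𝟙 (a + b) ⊗ mid a a b b ≈ 𝟙 a ⊗ ((𝟙 (b + a) ⊗ TBr a b) ⊗ 𝟙 b).
  by rewrite /mid -!tens_id !tensA.
have R2 : mid a (a + a) b (b + b) ≈ 𝟙 a ⊗ ((TBr (a + a) b ⊗ 𝟙 b) ⊗ 𝟙 b).
  by rewrite /mid -!tens_id !tensA.
rewrite L1 L2 R1 R2 -!tens_compl; rwr (tens_compr b); rwr (tens_compr b).
apply: TTens_Proper => //; apply: TTens_Proper => //.
rewrite br_hexl br_hexr tens_compl; rw (tens_compr b).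
rewrite -!compA -(tensA (𝟙 a) (𝟙 b)) (tensA (TBr a b) (𝟙 a)) !tens_id.
rw (exchange (b := (b + a)%N) (c := (a + b)%N)); by rewrite tensA.
Qed.

(** Both sides move the strands a b a b a b to a a a b b b. *)
Lemma mid_assoc a b :
  mid (a + a) (b + b) a b ∘ (mid a b a b ⊗ 𝟙 (a + b)) ≈
  mid a b (a + a) (b + b) ∘ (𝟙 (a + b) ⊗ mid a b a b).
Proof.
have L1 : mid a b a b ⊗ 𝟙 (a + b) ≈ 𝟙 a ⊗ ((TBr b a ⊗ 𝟙 (b + a)) ⊗ 𝟙 b).
  by rewrite /mid -!tens_id !tensA.
have L2 : mid (a + a) (b + b) a b ≈ 𝟙 a ⊗ ((𝟙 a ⊗ TBr (b + b) a) ⊗ 𝟙 b).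
  by rewrite /mid -!tens_id !tensA.
have R1 : 𝟙 (a + b) ⊗ mid a b a b ≈ 𝟙 a ⊗ ((𝟙 (b + a) ⊗ TBr b a) ⊗ 𝟙 b).
  by rewrite /mid -!tens_id !tensA.
have R2 : mid a b (a + a) (b + b) ≈ 𝟙 a ⊗ ((TBr b (a + a) ⊗ 𝟙 b) ⊗ 𝟙 b).
  by rewrite /mid -!tens_id !tensA.
rewrite L1 L2 R1 R2 -!tens_compl; rwr (tens_compr b); rwr (tens_compr b).
apply: TTens_Proper => //; apply: TTens_Proper => //.
rewrite br_hexl br_hexr tens_compl; rw (tens_compr b).
rewrite !compA -(tensA (𝟙 a) (𝟙 b)) (tensA (TBr b a) (𝟙 a)) !tens_id.
rwr (exchange (a := (b + a)%N) (d := (a + b)%N)); by rewrite tensA.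
Qed.

(** [Dm n] produces two consecutive copies of all n strands: [mid] moves the second copy of the
    first strand behind the first copies of the others. *)
Fixpoint Dm n := if n is n'.+1 then mid 1 1 n' n' ∘ (De ⊗ Dm n') else 𝟙 0.
Fixpoint Em n := if n is n'.+1 then ep ⊗ Em n' else 𝟙 0.
Definition pair m f g := (f ⊗ g) ∘ Dm m.

#[local] Instance pair_Proper m : Proper (eqv ==> eqv ==> eqv) (pair m).
Proof. by rewrite /pair => f f' e g g' e'; rewrite e e'. Qed.

Lemma dom_D m : dom (Dm m) = m. Proof. by elim: m => //= m ->. Qed.
Lemma cod_D m : cod (Dm m) = (m + m)%N. Proof. by elim: m => //= m IH; lia. Qed.
Lemma dom_E m : dom (Em m) = m. Proof. by elim: m => //= m ->. Qed.
Lemma cod_E m : cod (Em m) = 0%N. Proof. by elim: m. Qed.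

Ltac tc ::= rewrite ?/pair ?/mid /= ?dom_D ?cod_D ?dom_E ?cod_E; lia.

(** Splits off the first strand, where [Dm] is just [De]; this is the induction step for the counit
    and coassociativity laws of [Dm]. *)
Lemma pair_tens m f1 f2 g1 g2 a1 a2 b1 b2 :
  dom f1 = 1%N -> dom f2 = 1%N -> dom g1 = m -> dom g2 = m ->
  cod f1 = a1 -> cod f2 = a2 -> cod g1 = b1 -> cod g2 = b2 ->
  pair m.+1 (f1 ⊗ g1) (f2 ⊗ g2) ≈
  mid a1 a2 b1 b2 ∘ (((f1 ⊗ f2) ∘ De) ⊗ pair m g1 g2).
Proof.
move=> *; rewrite /pair /= -compA.
rewrite <- (mid_nat (a' := a1) (b' := a2) (c' := b1) (d' := b2)) by tc.
rewrite compA; by rw tens_comp.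
Qed.

Lemma counitl : (ep ⊗ 𝟙 1) ∘ De ≈ 𝟙 1.
Proof. exact: eqv_gen (v_counitl k) _ _ _ _ _ _. Qed.

Lemma counitr : (𝟙 1 ⊗ ep) ∘ De ≈ 𝟙 1.
Proof. exact: eqv_gen (v_counitr k) _ _ _ _ _ _. Qed.

Lemma D_counitl m : pair m (Em m) (𝟙 m) ≈ 𝟙 m.
Proof.
elim: m => [|m IH]; first by rewrite /pair /= tens0l; rw comp_idl.
rewrite /= -(tens_id 1 m).
rewrite -> (pair_tens (a1 := 0) (a2 := 1) (b1 := 0) (b2 := m)) by tc.
rewrite IH mid_c0 counitl; by rw comp_idl.
Qed.

Lemma D_counitr m : pair m (𝟙 m) (Em m) ≈ 𝟙 m.
Proof.
elim: m => [|m IH]; first by rewrite /pair /= tens0l; rw comp_idl.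
rewrite /= -(tens_id 1 m).
rewrite -> (pair_tens (a1 := 1) (a2 := 0) (b1 := m) (b2 := 0)) by tc.
rewrite IH mid_b0 counitr; by rw comp_idl; rewrite ?addn0.
Qed.

Lemma pair_comp m p q f g : cod f = dom p -> (p ⊗ q) ∘ pair m f g ≈ pair m (p ∘ f) (q ∘ g).
Proof. by move=> e; rewrite /pair -compA tens_comp. Qed.

Lemma De_coassoc : (De ⊗ 𝟙 1) ∘ De ≈ (𝟙 1 ⊗ De) ∘ De.
Proof. exact: eqv_gen (v_coassoc k) _ _ _ _ _ _. Qed.

Lemma De_cocomm : TBr 1 1 ∘ De ≈ De.
Proof. by symmetry; exact: eqv_gen (v_cocomm k) _ _ _ _ _ _. Qed.

(** The first strand contributes [De_coassoc], the others the induction hypothesis, and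
    [mid_coassoc] identifies the two ways of shuffling the three copies together. *)
Lemma D_coassoc m : pair m (Dm m) (𝟙 m) ≈ pair m (𝟙 m) (Dm m).
Proof.
elim: m => [|m IH]; first by [].
have e n : 𝟙 n.+1 ≈ 𝟙 1 ⊗ 𝟙 n by rewrite tens_id.
transitivity ((mid 1 1 m m ⊗ 𝟙 m.+1) ∘ pair m.+1 (De ⊗ Dm m) (𝟙 m.+1)).
  rw pair_comp; by rw (comp_idl (n := m.+1)).
rewrite {2}e.
rewrite -> (pair_tens (a1 := 2) (a2 := 1) (b1 := m + m) (b2 := m)) by tc.
rewrite IH De_coassoc -compA (mid_coassoc 1 m) compA.
rewrite <- (pair_tens (a1 := 1) (a2 := 2) (b1 := m) (b2 := m + m)) by tc.
rw pair_comp; rw (comp_idl (n := m.+1)).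
by rewrite -e.
Qed.

(** Expanding the large braiding by the hexagons produces a [TBr m 1] that undoes the crossing
    inside [mid], by [br1nK]. *)
Lemma br_mid m :
  TBr m.+1 m.+1 ∘ mid 1 1 m m ≈ mid 1 1 m m ∘ (TBr 1 1 ⊗ TBr m m).
Proof.
rewrite -(add1n m) (br_hexl (1 + m) 1 m) (br_hexr 1 m 1) (br_hexr 1 m m) compA.
have -> : (TBr 1 1 ⊗ 𝟙 m ∘ 𝟙 1 ⊗ TBr m 1) ⊗ 𝟙 m ∘ mid 1 1 m m ≈ TBr 1 1 ⊗ 𝟙 (m + m).
  rw tens_compr; rewrite /mid compA (tensA (𝟙 1)); rwr tens_compl.
  rwr tens_compr; rewrite br1nK tens_id tens_id; rw comp_idr.
  by rewrite tensA tens_id.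
rewrite tens_compl compA -(tensA (𝟙 1) (𝟙 1)) tens_id; rw tens_comp.
by rw comp_idl; rw comp_idr.
Qed.

Lemma D_cocomm m : TBr m m ∘ Dm m ≈ Dm m.
Proof.
elim: m => [|m IH] /=; first by rewrite br0n; rw comp_idl.
rewrite -compA br_mid compA; rw tens_comp; by rewrite IH De_cocomm.
Qed.

Lemma pairA m f g h : dom f = m -> dom g = m -> dom h = m ->
  pair m (pair m f g) h ≈ pair m f (pair m g h).
Proof.
move=> *; transitivity (((f ⊗ g) ⊗ h) ∘ pair m (Dm m) (𝟙 m)).
  rw pair_comp; by rw comp_idr.
rewrite D_coassoc tensA; rw pair_comp; by rw comp_idr.
Qed.

Lemma pairEl m f : dom f = m -> pair m (Em m) f ≈ f.
Proof.
move=> df; transitivity ((𝟙 0 ⊗ f) ∘ pair m (Em m) (𝟙 m)).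
  rw pair_comp; rw comp_idl; by rw comp_idr.
by rewrite D_counitl tens0l; rw comp_idr.
Qed.

Lemma pairEr m f : dom f = m -> pair m f (Em m) ≈ f.
Proof.
move=> df; transitivity ((f ⊗ 𝟙 0) ∘ pair m (𝟙 m) (Em m)).
  rw pair_comp; rw comp_idl; by rw comp_idr.
by rewrite D_counitr tens0r; rw comp_idr.
Qed.

(** Naturality carries the braiding down to [Dm], where cocommutativity absorbs it. *)
Lemma pair_br m a b f g : cod f = a -> cod g = b -> dom f = m -> dom g = m ->
  TBr a b ∘ pair m f g ≈ pair m g f.
Proof.
move=> *; rewrite /pair -compA.
rewrite -> (br_nat (c := m) (d := m)) by tc.
by rewrite compA D_cocomm.
Qed.

Lemma pair_mid m a b c d f g h i :
  dom f = m -> dom g = m -> dom h = m -> dom i = m ->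
  cod f = a -> cod g = b -> cod h = c -> cod i = d ->
  mid a b c d ∘ pair m (pair m f g) (pair m h i) ≈ pair m (pair m f h) (pair m g i).
Proof.
move=> *; rw (pairA (f := f) (g := g)); rwr (pairA (f := g) (g := h)).
rewrite /mid; rw pair_comp; rw pair_comp; rw pair_br.
rw comp_idl; rw comp_idl; by rw (pairA (f := h)); rw (pairA (f := f)).
Qed.

(** * Convolution monoids *)

Definition conv M m f g := M ∘ pair m f g.

#[local] Instance conv_Proper M m : Proper (eqv ==> eqv ==> eqv) (conv M m).
Proof. by rewrite /conv => f f' e g g' e'; rewrite e e'. Qed.

(** The object is left general because convolution is used both into 1, with [mu], and into 2, with
    [mu2]. *)
Record monoid n (M U : Tm) := Monoid {
  mon_dom : dom M = (n + n)%N; mon_cod : cod M = n; mon_udom : dom U = 0; mon_ucod : cod U = n;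
  mon_assoc : M ∘ (M ⊗ 𝟙 n) ≈ M ∘ (𝟙 n ⊗ M);
  mon_unitl : M ∘ (U ⊗ 𝟙 n) ≈ 𝟙 n;
  mon_unitr : M ∘ (𝟙 n ⊗ U) ≈ 𝟙 n }.

Section Convolution.
Variables (n : nat) (M U : Tm) (mM : monoid n M U).

Lemma convA m f g h : dom f = m -> dom g = m -> dom h = m ->
  cod f = n -> cod g = n -> cod h = n ->
  conv M m (conv M m f g) h ≈ conv M m f (conv M m g h).
Proof.
case: mM => dM cM _ _ A _ _ df dg dh cf cg ch; rewrite /conv.
transitivity (M ∘ ((M ⊗ 𝟙 n) ∘ pair m (pair m f g) h)).
  rw pair_comp; by rw (comp_idl (f := h)).
rewrite -compA A compA; rw pairA; rw pair_comp; by rw (comp_idl (f := f)).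
Qed.

Lemma conv_unitl m f : dom f = m -> cod f = n -> conv M m (U ∘ Em m) f ≈ f.
Proof.
case: mM => dM cM dU cU _ A _ df cf; rewrite /conv.
transitivity (M ∘ ((U ⊗ 𝟙 n) ∘ pair m (Em m) f)).
  rw pair_comp; by rw (comp_idl (f := f)).
by rewrite -compA A; rw pairEl; rw comp_idl.
Qed.

Lemma conv_unitr m f : dom f = m -> cod f = n -> conv M m f (U ∘ Em m) ≈ f.
Proof.
case: mM => dM cM dU cU _ _ A df cf; rewrite /conv.
transitivity (M ∘ ((𝟙 n ⊗ U) ∘ pair m f (Em m))).
  rw pair_comp; by rw (comp_idl (f := f)).
by rewrite -compA A; rw pairEr; rw comp_idl.
Qed.

(** A left inverse equals a right inverse: f = f * (g * h) = (f * g) * h = h. *)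
Lemma conv_inv_unique m f g h : dom f = m -> dom g = m -> dom h = m ->
  cod f = n -> cod g = n -> cod h = n ->
  conv M m f g ≈ U ∘ Em m -> conv M m g h ≈ U ∘ Em m -> f ≈ h.
Proof.
move=> df dg dh cf cg ch fg gh.
by rwr (conv_unitr (f := f) df); rewrite -gh; rwr convA; rewrite fg; rw conv_unitl.
Qed.
End Convolution.

(** * The Hopf relations and the antipode as a coalgebra map *)

Lemma mu_monoid : monoid 1 mu un.
Proof.
split=> //; first exact: eqv_gen (v_assoc k) _ _ _ _ _ _.
  exact: eqv_gen (v_unitl k) _ _ _ _ _ _.
exact: eqv_gen (v_unitr k) _ _ _ _ _ _.
Qed.

Definition mu2 := (mu ⊗ mu) ∘ mid 1 1 1 1.

(** Naturality moves the multiplications and units past [mid]; then [mid_assoc] matches the two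
    shuffles, and the laws of [mu] apply in each factor. *)
Lemma mu2_monoid : monoid 2 mu2 (un ⊗ un).
Proof.
have [_ _ _ _ A ul ur] := mu_monoid.
have e : 𝟙 2 ≈ 𝟙 1 ⊗ 𝟙 1 by rewrite tens_id.
split=> //; rewrite /mu2.
- transitivity ((mu ⊗ mu) ∘ (mid 1 1 1 1 ∘ ((mu ⊗ mu) ⊗ (𝟙 1 ⊗ 𝟙 1))) ∘ (mid 1 1 1 1 ⊗ 𝟙 2)).
    rewrite !compA; rw (tens_comp _ _ (f := mu ⊗ mu)); by rw (comp_idr (n := 2)); rewrite -e.
  rewrite -> (mid_nat (a := 2) (b := 2) (c := 1) (d := 1)) by tc.
  rewrite !compA (mid_assoc 1 1) -compA; rw tens_comp; rewrite A; rwr tens_comp.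
  rewrite compA -(compA (_ ⊗ _) (mid _ _ _ _)).
  rewrite <- (mid_nat (a' := 1) (b' := 1) (c' := 1) (d' := 1)) by tc.
  rewrite !compA tens_id; rw tens_comp; by rw (comp_idl (n := 2)).
- rewrite e compA.
  rewrite -> (mid_nat (a := 0) (b := 0) (c := 1) (d := 1)) by tc.
  rewrite mid_b0; rw comp_idr; rw tens_comp; by rewrite ul.
- rewrite e compA.
  rewrite -> (mid_nat (a := 1) (b := 1) (c := 0) (d := 0)) by tc.
  rewrite mid_c0; rw comp_idr; rw tens_comp; by rewrite ur.
Qed.

Lemma D1 : Dm 1 ≈ De.
Proof. by rewrite /= mid_c0 tens0r; rw comp_idl. Qed.

Lemma E1 : Em 1 ≈ ep.
Proof. exact: tens0r. Qed.

Lemma antil : mu ∘ ((An ⊗ 𝟙 1) ∘ De) ≈ un ∘ ep.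
Proof. exact: eqv_gen (v_antil k) _ _ _ _ _ _. Qed.

Lemma antir : mu ∘ ((𝟙 1 ⊗ An) ∘ De) ≈ un ∘ ep.
Proof. exact: eqv_gen (v_antir k) _ _ _ _ _ _. Qed.

Lemma ep_un : ep ∘ un ≈ 𝟙 0.
Proof. exact: eqv_gen (v_epu k) _ _ _ _ _ _. Qed.

Lemma ep_mu : ep ∘ mu ≈ ep ⊗ ep.
Proof. exact: eqv_gen (v_epmu k) _ _ _ _ _ _. Qed.

Lemma De_un : De ∘ un ≈ un ⊗ un.
Proof. exact: eqv_gen (v_Deu k) _ _ _ _ _ _. Qed.

Lemma De_mu : De ∘ mu ≈ mu2 ∘ (De ⊗ De).
Proof. by rewrite /mu2 compA; exact: eqv_gen (v_Demu k) _ _ _ _ _ _. Qed.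

(** Apply the counit to the antipode axiom: multiplicativity of [ep] and the counit law leave
    [ep ∘ An] on one side and [ep] on the other. *)
Lemma ep_An : ep ∘ An ≈ ep.
Proof.
transitivity (ep ∘ (un ∘ ep)); last by rewrite -compA ep_un; rw comp_idl.
rewrite -antil -(compA ep) ep_mu -compA; rw tens_comp; rw comp_idr.
transitivity (((ep ∘ An) ⊗ 𝟙 0) ∘ ((𝟙 1 ⊗ ep) ∘ De)).
  by rewrite counitr tens0r; rw comp_idr.
by rewrite -compA; rw tens_comp; rw (comp_idl (n := 0)); rw (comp_idr (n := 1)).
Qed.

Lemma un_pair m : (un ⊗ un) ∘ Em m ≈ pair m (un ∘ Em m) (un ∘ Em m).
Proof.
rwr pair_comp; by rw pairEl.
Qed.

(* Both sides are convolution inverses of De in Hom(1, 2). *)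
Lemma De_An : De ∘ An ≈ (An ⊗ An) ∘ De.
Proof.
apply: (conv_inv_unique mu2_monoid (m := 1) (g := De)) => //.
  rewrite /conv /pair D1; transitivity (mu2 ∘ ((De ⊗ De) ∘ ((An ⊗ 𝟙 1) ∘ De))).
    by rewrite -(compA (De ⊗ De)); rw tens_comp; rw (comp_idr (n := 1)).
  by rewrite -compA -De_mu compA antil E1 -De_un compA.
have eD : De ≈ pair 1 (𝟙 1) (𝟙 1) by rewrite /pair tens_id D1; rw comp_idl.
have eS : (An ⊗ An) ∘ De ≈ pair 1 An An by rewrite /pair D1.
(* By cocommutativity, through [pair_mid], the four copies regroup into two convolutions of [𝟙 1]
   with [An], one per tensor factor. *)
rewrite eS eD /conv /mu2 compA; rw pair_mid; rw pair_comp.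
have -> : mu ∘ pair 1 (𝟙 1) An ≈ un ∘ Em 1 by rewrite /pair D1 antir E1.
by rewrite -un_pair.
Qed.

(** * Grouplike morphisms and projections *)

(** These are the coalgebra maps from m to 1, seen as grouplike generalized elements of the Hopf
    object. *)
Definition grouplike m f :=
  [/\ dom f = m, cod f = 1%N, De ∘ f ≈ pair m f f & ep ∘ f ≈ Em m].

Lemma grouplike_un m : grouplike m (un ∘ Em m).
Proof.
split=> //; first exact: dom_E.
  by rewrite -compA De_un un_pair.
by rewrite -compA ep_un; rw comp_idl.
Qed.

Lemma grouplike_mu m f g : grouplike m f -> grouplike m g ->
  grouplike m (conv mu m f g).
Proof.
move=> [df cf Df Ef] [dg cg Dg Eg]; split=> //; rewrite /conv; first tc.
  rewrite -(compA De) De_mu compA; rw pair_comp; rewrite Df Dg /mu2 compA; rw pair_mid.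
  by rw pair_comp.
by rewrite -(compA ep) ep_mu; rw pair_comp; rewrite Ef Eg; rw pairEl.
Qed.

Lemma grouplike_An m f : grouplike m f -> grouplike m (An ∘ f).
Proof.
move=> [df cf Df Ef]; split=> //; rewrite -?compA.
  by rewrite De_An compA Df; rw pair_comp.
by rewrite ep_An.
Qed.

(* pr m j is the j-th projection; for j >= m it is the junk but grouplike value
   eps (x) ... (x) eps (x) u. *)
Fixpoint pr m j := match m, j with
  | 0, _ => un
  | m'.+1, 0 => 𝟙 1 ⊗ Em m'
  | m'.+1, j'.+1 => ep ⊗ pr m' j'
  end.

Lemma grouplike_pr m j : grouplike m (pr m j).
Proof.
elim: m j => [|m IH] [|j] /=.
- split=> //; first by rewrite De_un /pair /=; rw comp_idr.
  exact: ep_un.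
- split=> //; first by rewrite De_un /pair /=; rw comp_idr.
  exact: ep_un.
- split; [tc|tc| |].
    rewrite -> (pair_tens (a1 := 1) (a2 := 1) (b1 := 0) (b2 := 0)) by tc.
    rewrite tens_id mid_c0; rw comp_idl; rw comp_idl; rw pairEl.
    rewrite -{1}(tens0r De); rw tens_comp; by rw comp_idr; rw comp_idl.
  rewrite -{1}(tens0r ep); rw tens_comp; by rw comp_idr; rw comp_idl.
have [d c DD EE] := IH j; split; [tc|tc| |].
  rewrite -> (pair_tens (a1 := 0) (a2 := 0) (b1 := 1) (b2 := 1)) by tc.
  rewrite mid_b0 -DD.
  transitivity ((𝟙 0 ∘ ep) ⊗ (De ∘ pr m j)).
    by rwr tens_comp; rewrite tens0l.
  rw comp_idl; rw comp_idl; have -> : ep ⊗ ep ∘ De ≈ ep; last by [].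
  by rewrite -D1 -E1; apply: (pairEl (m := 1)); tc.
transitivity ((𝟙 0 ∘ ep) ⊗ (ep ∘ pr m j)).
  by rwr tens_comp; rewrite tens0l.
by rw comp_idl; rewrite EE.
Qed.

(** * Words in the projections and the action of terms on tuples of words *)

Definition letter m (a : nat * bool) := if a.2 then An ∘ pr m a.1 else pr m a.1.
Definition word m (w : W) := foldr (fun a f => conv mu m (letter m a) f) (un ∘ Em m) w.
Definition tupling m := foldr (fun f F => pair m f F) (Em m).
Definition words m (ws : seq W) := tupling m [seq word m w | w <- ws].

Lemma grouplike_letter m a : grouplike m (letter m a).
Proof.
rewrite /letter; case: a.2; last exact: grouplike_pr.
exact/grouplike_An/grouplike_pr.
Qed.

Lemma grouplike_word m w : grouplike m (word m w).
Proof.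
elim: w => [|a w IH]; first exact: grouplike_un.
exact: grouplike_mu (grouplike_letter m a) IH.
Qed.

Lemma dom_pr m j : dom (pr m j) = m. Proof. by case: (grouplike_pr m j). Qed.
Lemma cod_pr m j : cod (pr m j) = 1%N. Proof. by case: (grouplike_pr m j). Qed.
Lemma dom_letter m a : dom (letter m a) = m. Proof. by case: (grouplike_letter m a). Qed.
Lemma cod_letter m a : cod (letter m a) = 1%N. Proof. by case: (grouplike_letter m a). Qed.
Lemma dom_word m w : dom (word m w) = m. Proof. by case: (grouplike_word m w). Qed.
Lemma cod_word m w : cod (word m w) = 1%N. Proof. by case: (grouplike_word m w). Qed.

Lemma dom_words m ws : dom (words m ws) = m.
Proof. by case: ws => [|w ws] /=; rewrite ?dom_D ?dom_E. Qed.

Lemma cod_words m ws : cod (words m ws) = size ws.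
Proof. by elim: ws => [|w ws IH] /=; rewrite ?cod_E // cod_word IH. Qed.

Ltac tc ::= rewrite ?/conv ?/pair ?/mid /= ?dom_D ?cod_D ?dom_E ?cod_E ?dom_words ?cod_words
  ?dom_word ?cod_word ?dom_letter ?cod_letter ?dom_pr ?cod_pr; lia.

(** Grouplikeness turns [pair m f f] into [De ∘ f], so the antipode axiom can be precomposed with
    f. *)
Lemma antipode_convl m f : grouplike m f -> conv mu m (An ∘ f) f ≈ un ∘ Em m.
Proof.
move=> [df cf Df Ef]; rewrite /conv.
transitivity (mu ∘ ((An ⊗ 𝟙 1) ∘ pair m f f)).
  rw pair_comp; by rw (comp_idl (n := 1)).
by rewrite -Df -(compA _ De f) -compA antil compA Ef.
Qed.

Lemma antipode_convr m f : grouplike m f -> conv mu m f (An ∘ f) ≈ un ∘ Em m.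
Proof.
move=> [df cf Df Ef]; rewrite /conv.
transitivity (mu ∘ ((𝟙 1 ⊗ An) ∘ pair m f f)).
  rw pair_comp; by rw (comp_idl (n := 1)).
by rewrite -Df -(compA _ De f) -compA antir compA Ef.
Qed.

Lemma letter_cancel m a b : a.1 = b.1 -> a.2 != b.2 ->
  conv mu m (letter m a) (letter m b) ≈ un ∘ Em m.
Proof.
rewrite /letter => ->; case: a.2; case: b.2 => // _.
  exact/antipode_convl/grouplike_pr.
exact/antipode_convr/grouplike_pr.
Qed.

Lemma word_push m a w : word m (pushF a w) ≈ conv mu m (letter m a) (word m w).
Proof.
case: w => [|b w] //=; case: ifP => // /andP[/eqP e1 e2].
rewrite <- (convA mu_monoid) by tc.
by rewrite letter_cancel //; rewrite -> (conv_unitl mu_monoid) by tc.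
Qed.

Lemma word_mul m u v : word m (mulF u v) ≈ conv mu m (word m u) (word m v).
Proof.
elim: u => [|a u IH] /=; first by rewrite -> (conv_unitl mu_monoid) by tc.
rewrite word_push IH; by rewrite -> (convA mu_monoid) by tc.
Qed.

(** Both sides are convolution inverses of [word m w]. *)
Lemma word_inv m w : An ∘ word m w ≈ word m (invF w).
Proof.
apply: (conv_inv_unique mu_monoid (m := m) (g := word m w)); try tc.
  exact/antipode_convl/grouplike_word.
by rewrite -word_mul mulFV.
Qed.

Lemma words_cat m ws ws' : words m (ws ++ ws') ≈ pair m (words m ws) (words m ws').
Proof.
elim: ws => [|w ws IH] /=; first by rw pairEl.
rewrite /words /= -/(words m _) IH; by rw pairA.
Qed.

(** The product acts by [word_mul], the antipode by [word_inv], [De] and [ep] by grouplikeness of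
    words, and braidings by [pair_br]. *)
Lemma eval_words m t ws : wt t -> size ws = dom t ->
  t ∘ words m ws ≈ words m (evalG t ws).
Proof.
elim: t ws => [n|a b|a b|[]|f IHf g IHg|f IHf g IHg] ws /= wtt sz.
- by rw comp_idl.
- rewrite -{1}(cat_take_drop a ws) !words_cat.
  rewrite -> pair_br; rewrite ?cod_words ?dom_words //.
    by rewrite size_takel // sz leq_addr.
  by rewrite size_drop sz /= addKn.
- rewrite -{1}(cat_take_drop b ws) !words_cat.
  have s1 : size (take b ws) = b by rewrite size_takel // sz leq_addr.
  have s2 : size (drop b ws) = a by rewrite size_drop sz /= addKn.
  (* Backwards, this exhibits the tuple as a braiding applied to the swapped tuple, which the
     inverse braiding then undoes. *)
  rewrite <- (pair_br (a := a) (b := b)); rewrite ?cod_words ?dom_words //.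
  by rewrite -compA brI_l; rw comp_idl.
- case: ws sz => [|u [|v []]] //= _.
  rewrite /words /= word_mul; rw pairEr; by rw pairEr.
- case: ws sz => //= _; rewrite /words /=; by rw pairEr.
- case: ws sz => [|u []] //= _; rewrite /words /=; rw pairEr.
  by have [_ _ -> _] := grouplike_word m u.
- case: ws sz => [|u []] //= _; rewrite /words /=; rw pairEr.
  by have [_ _ _ ->] := grouplike_word m u.
- case: ws sz => [|u []] //= _; rewrite /words /=; rw pairEr; rw pairEr.
  exact: word_inv.
- case/and3P: wtt => wf wg /eqP e.
  by rewrite compA IHg // IHf // size_evalG.
- case/andP: wtt => wf wg.
  have sf : size (take (dom f) ws) = dom f by rewrite size_takel // sz leq_addr.
  rewrite -{1}(cat_take_drop (dom f) ws) !words_cat; rw pair_comp.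
  by rewrite IHf // IHg // size_drop sz addKn.
Qed.

(** * The generic tuple determines a term modulo the ideal *)

Definition gens m : seq W := [seq [:: (j, false)] | j <- iota 0 m].

(** An input discarded by every entry can be discarded once, since [(ep ⊗ ep) ∘ De] is [ep]. *)
Lemma tuple_tens m fs : all (fun f => dom f == m) fs ->
  tupling m.+1 [seq ep ⊗ f | f <- fs] ≈ ep ⊗ tupling m fs.
Proof.
elim: fs => [|f fs IH] //= /andP[/eqP df dfs].
have d : dom (tupling m fs) = m by case: (fs) => [|? ?] /=; tc.
rewrite IH //.
rewrite -> (pair_tens (a1 := 0) (a2 := 0) (b1 := cod f) (b2 := cod (tupling m fs))) by tc.
rewrite mid_b0; rw comp_idl; have -> : ep ⊗ ep ∘ De ≈ ep; last by [].
by rewrite -D1 -E1; apply: (pairEl (m := 1)); tc.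
Qed.

(** The later projections form [ep ⊗ 𝟙 m] by induction; pairing the first projection with it gives
    the identity by the counit laws. *)
Lemma tuple_pr m : tupling m [seq pr m j | j <- iota 0 m] ≈ 𝟙 m.
Proof.
elim: m => //= m IH; rewrite (iotaDl 1 0 m) -map_comp.
rewrite (eq_map (g := (fun f => ep ⊗ f) \o pr m)) // map_comp tuple_tens.
  rewrite IH.
  rewrite -> (pair_tens (a1 := 1) (a2 := 0) (b1 := 0) (b2 := m)) by tc.
  rewrite counitr D_counitl mid_b0; by rw comp_idl; rewrite tens_id.
by rewrite all_map; apply/allP => j _ /=; rewrite dom_pr eqxx.
Qed.

Lemma words_gens m : words m (gens m) ≈ 𝟙 m.
Proof.
rewrite -tuple_pr /words /gens -map_comp.
elim: iota => //= j s ->; rewrite -> (conv_unitr mu_monoid) by tc.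
by [].
Qed.

Lemma eqv_words m t : wt t -> dom t = m -> t ≈ words m (evalG t (gens m)).
Proof.
move=> w d; rewrite -eval_words // ?words_gens; first by rw comp_idr.
by rewrite size_map size_iota.
Qed.

Lemma eqv_evalG t t' : wt t -> wt t' -> dom t = dom t' ->
  evalG t (gens (dom t)) = evalG t' (gens (dom t)) -> t ≈ t'.
Proof.
by move=> w w' d e; rewrite (eqv_words w erefl) (eqv_words w' (esym d)) e.
Qed.

End Congruence.

(** * Soundness of evaluation in the free group *)

Definition noncancel (a b : nat * bool) := ~~ ((a.1 == b.1) && (a.2 != b.2)).

Lemma noncancel_sym : symmetric noncancel.
Proof. by move=> [i p] [j q]; rewrite /noncancel /= eq_sym (eq_sym p). Qed.

(** In this form the library lemmas on sorted sequences apply to reversal, mapping and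
    concatenation. *)
Lemma reducedbE w : reducedb w = sorted noncancel w.
Proof. by elim: w => // a [|b w] //= ->. Qed.

Lemma reduced_behead a w : reducedb (a :: w) -> reducedb w.
Proof. by rewrite !reducedbE; apply: path_sorted. Qed.

Lemma reduced_push a w : reducedb w -> reducedb (pushF a w).
Proof.
case: w => [|b w] //= rw; case: ifP => [_|e]; first exact: reduced_behead rw.
by rewrite /= e.
Qed.

Lemma reduced_mul u v : reducedb v -> reducedb (mulF u v).
Proof. by move=> rv; elim: u => //= a u IH; apply: reduced_push. Qed.

Lemma reduced_inv w : reducedb w -> reducedb (invF w).
Proof.
rewrite !reducedbE /invF rev_sorted sorted_map; apply: sub_sorted => a b.
by rewrite noncancel_sym /noncancel /=; case: a.2; case: b.2.
Qed.

Lemma mulF_cat u v : reducedb (u ++ v) -> mulF u v = u ++ v.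
Proof.
elim: u => //= a u IH r; rewrite IH; last by case: (u ++ v) r => //= b w /andP[].
by case: (u ++ v) r => //= b w /andP[/negPf ->].
Qed.

Lemma mulF_nil w : reducedb w -> mulF w [::] = w.
Proof. by move=> r; rewrite mulF_cat cats0. Qed.

(** Letters permute the reduced words, opposite letters acting inversely: van der Waerden's route to
    associativity in the free group. *)
Lemma pushFK a b w : reducedb w -> a.1 = b.1 -> a.2 != b.2 -> pushF a (pushF b w) = w.
Proof.
case: a b => [i p] [j q] /= + -> pq; case: w => [|[l r] w] /=; first by rewrite eqxx pq.
case: ifP => [/andP[/eqP <- qr]|_] rw; last by rewrite /= eqxx pq.
(* Signs take two values, so [a] is the very letter that [b] removed; reducedness lets it return
   without a new cancellation. *)
have -> : p = r by move: pq qr; case: (p); case: (q); case: (r).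
by case: w rw => //= b w /andP[/negPf ->].
Qed.

Lemma mulF_push a u v : reducedb v -> mulF (pushF a u) v = pushF a (mulF u v).
Proof.
move=> rv; case: u => [|b u] //=; case: ifP => // /andP[/eqP e n].
by rewrite pushFK // reduced_mul.
Qed.

Lemma mulFA u v w : reducedb w -> mulF (mulF u v) w = mulF u (mulF v w).
Proof. by move=> rw; elim: u => //= a u IH; rewrite mulF_push // IH. Qed.

(** The hypothesis on the empty word covers both the unit and the default value of [nth]. *)
Lemma all_evalG (p : pred W) t g :
  p [::] -> (forall u v, p u -> p v -> p (mulF u v)) -> (forall u, p u -> p (invF u)) ->
  all p g -> all p (evalG t g).
Proof.
move=> p0 pM pV.
have pn h i : all p h -> p (nth [::] h i).
  by move=> ph; have [/(all_nthP [::] ph)//|?] := ltnP i (size h); rewrite nth_default.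
have pt i h : all p h -> all p (take i h) && all p (drop i h).
  by rewrite -all_cat cat_take_drop.
elim: t g => [n|a b|a b|o|f IHf h IHh|f IHf h IHh] g //= pg.
- by rewrite all_cat andbC pt.
- by rewrite all_cat andbC pt.
- by case: o => //=; rewrite ?andbT ?pn ?pM ?pV ?pn.
- by apply: IHf; apply: IHh.
by rewrite all_cat; have /andP[? ?] := pt (dom f) g pg; rewrite IHf // IHh.
Qed.

HB.instance Definition _ := hasDecEq.Build Tm (compareP Tm_eq_dec).

(** * Every element of the ideal is an identity of the free group algebra *)

Section Soundness.
Variable k : fieldType.

Lemma evalG_comp f h u : evalG (TComp f h) u = evalG f (evalG h u).
Proof. by []. Qed.

Lemma evalG_cat f h u v : size u = dom f -> evalG (TTens f h) (u ++ v) = evalG f u ++ evalG h v.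
Proof. by move=> s /=; rewrite take_size_cat // drop_size_cat. Qed.

Lemma evalG_br a b u v : size u = a -> evalG (TBr a b) (u ++ v) = v ++ u.
Proof. by move=> s /=; rewrite take_size_cat // drop_size_cat. Qed.

Lemma evalG_brI a b u v : size u = b -> evalG (TBrI a b) (u ++ v) = v ++ u.
Proof. by move=> s /=; rewrite take_size_cat // drop_size_cat. Qed.

Lemma size_add_cat (T : Type) (g : seq T) m n : size g = (m + n)%N ->
  exists u v, [/\ g = u ++ v, size u = m & size v = n].
Proof.
move=> s; exists (take m g), (drop m g); rewrite cat_take_drop; split=> //.
  by rewrite size_takel // s leq_addr.
by rewrite size_drop s addKn.
Qed.

Lemma polyId_rel m n f f' :
  (forall g, size g = m -> all reducedb g -> evalG f g = evalG f' g) ->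
  polyId m n (Defs.rel k f f').
Proof.
move=> e g sg rg h; rewrite !big_cons big_nil /= e //.
by case: (_ == h); rewrite ?addr0 ?subrr.
Qed.

Lemma StructAx_sound m n c : StructAx (k := k) m n c -> typed m n c /\ polyId m n c.
Proof.
case=> {m n c}.
- by move=> f w; split; [rewrite typed_rel /= w !eqxx|apply: polyId_rel].
- by move=> f w; split; [rewrite typed_rel /= w !eqxx|apply: polyId_rel].
- move=> f g h wf wg wh e e'; split; [by rewrite typed_rel /= wf wg wh e e' !eqxx|].
  exact: polyId_rel.
- move=> f g h wf wg wh; split; [by rewrite typed_rel /= wf wg wh !addnA !eqxx|].
  apply: polyId_rel => ? /size_add_cat[? [w [-> /size_add_cat[u [v [-> su sv]]] sw]]] _.
  rewrite evalG_cat ?size_cat ?su ?sv // evalG_cat //.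
  by rewrite -!catA !evalG_cat.
- move=> f w; split; [by rewrite typed_rel /= w !eqxx|].
  by apply: polyId_rel => g _ _ /=; rewrite take0 drop0.
- move=> f w; split; [by rewrite typed_rel /= w !addn0 !eqxx|].
  by apply: polyId_rel => g sg _ /=; rewrite -sg take_size drop_size cats0.
- move=> m n; split; [by rewrite typed_rel /= !eqxx|].
  by apply: polyId_rel => g _ _ /=; rewrite cat_take_drop.
- move=> f g f' g' wf wg wf' wg' e e'.
  split; [by rewrite typed_rel /= wf wg wf' wg' e e' !eqxx|].
  apply: polyId_rel => ? /size_add_cat[u [v [-> su sv]]] _.
  rewrite evalG_comp !evalG_cat //.
  by rewrite size_evalG.
- move=> f g wf wg; split; [by rewrite typed_rel /= wf wg !eqxx|].
  apply: polyId_rel => ? /size_add_cat[u [v [-> su sv]]] _.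
  rewrite evalG_comp evalG_cat // evalG_br ?size_evalG //.
  by rewrite evalG_comp evalG_br // evalG_cat.
- move=> m n p; split; [by rewrite typed_rel /= !addnA !eqxx|].
  apply: polyId_rel => ? /size_add_cat[? [w [-> /size_add_cat[u [v [-> su sv]]] sw]]] _.
  rewrite -{1}catA evalG_br // evalG_comp (evalG_cat (f := TBr m n)) ?size_cat ?su ?sv //.
  by rewrite evalG_br // -(catA v u) (evalG_cat (f := TId n)) // evalG_br // catA.
- move=> m n p; split; [by rewrite typed_rel /= !addnA !eqxx|].
  apply: polyId_rel => ? /size_add_cat[? [w [-> /size_add_cat[u [v [-> su sv]]] sw]]] _.
  rewrite evalG_br ?size_cat ?su ?sv // evalG_comp -catA (evalG_cat (f := TId m)) // evalG_br //.
  by rewrite !catA (evalG_cat (f := TBr m p)) ?size_cat ?su ?sw // evalG_br // catA.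
- move=> m n; split; [by rewrite typed_rel /= !eqxx|].
  apply: polyId_rel => ? /size_add_cat[u [v [-> su sv]]] _.
  by rewrite evalG_comp evalG_br // evalG_brI.
- move=> m n; split; [by rewrite typed_rel /= !eqxx|].
  apply: polyId_rel => ? /size_add_cat[u [v [-> su sv]]] _.
  by rewrite evalG_comp evalG_brI // evalG_br.
Qed.

Lemma VCocHopf_sound m n c : VCocHopf (k := k) m n c -> typed m n c /\ polyId m n c.
Proof.
case=> {m n c}; (split; first by []); apply: polyId_rel.
- by case=> [|a [|b []]].
- case=> [|a [|b [|c []]]] //= _ /and4P[ra rb rc _]; by rewrite mulFA.
- by case=> [|a []].
- case=> [|a []] //= _ /andP[ra _]; by rewrite mulF_nil.
- by case=> [|a []].
- by case=> [|a []].
- by case=> [|a []].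
- by case.
- by case=> [|a [|b []]].
- by case.
- by case=> [|a [|b []]].
- by case=> [|a []] //= _ _; rewrite mulVF.
- by case=> [|a []] //= _ _; rewrite mulFV.
- by case=> [|a []].
Qed.

(** Combinations may repeat a basis element, so the sum is regrouped by distinct values, each of
    whose fibres sums to zero. *)
Lemma sum_fibers0 (I : eqType) (s : seq (k * I)) (P : pred I) :
  (forall i, \sum_(p <- s | p.2 == i) p.1 = 0) -> \sum_(p <- s | P p.2) p.1 = 0.
Proof.
move=> s0; have -> : \sum_(p <- s | P p.2) p.1 =
    \sum_(i <- undup (unzip2 s) | P i) \sum_(p <- s | p.2 == i) p.1; last by rewrite big1.
rewrite (exchange_big_dep (fun p => P p.2)) /=; last by move=> i p Pi /eqP->.
rewrite big_seq_cond [RHS]big_seq_cond; apply: eq_bigr => p /andP[ps Pp].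
(* After the exchange only the index [p.2] contributes for a given p, and [undup] lists it once. *)
rewrite (big_rem p.2) /= ?mem_undup ?map_f // Pp eqxx big_seq_cond big1 ?addr0 // => i.
by case/and3P=> + _ /eqP e; rewrite -e (rem_filter _ (undup_uniq _)) mem_filter /= eqxx.
Qed.

Lemma coefE (c : seq (k * Tm)) t : coef c t = \sum_(p <- c | p.2 == t) p.1.
Proof.
rewrite /coef [RHS]big_mkcond; apply: eq_bigr => p _.
by case: Tm_eq_dec => /= [->|/eqP/negPf->]; rewrite ?eqxx.
Qed.

Lemma sum_coef0 (c : seq (k * Tm)) (P : pred Tm) :
  (forall t, coef c t = 0) -> \sum_(p <- c | P p.2) p.1 = 0.
Proof. by move=> c0; apply: sum_fibers0 => t; rewrite -coefE. Qed.

Lemma sum_eq_coef (c c' : seq (k * Tm)) (P : pred Tm) :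
  (forall t, coef c t = coef c' t) ->
  \sum_(p <- c | P p.2) p.1 = \sum_(p <- c' | P p.2) p.1.
Proof.
move=> e; apply/eqP; rewrite -subr_eq0 -mulN1r; apply/eqP.
rewrite -[RHS](sum_coef0 (c := c ++ scale (-1) c') P).
  by rewrite big_cat big_map mulr_sumr.
by move=> t; rewrite coef_cat coef_scale e mulN1r subrr.
Qed.

Lemma typed_map m n m' n' (F : Tm -> Tm) (c : seq (k * Tm)) :
  (forall t, wt t -> dom t = m -> cod t = n ->
     [/\ wt (F t), dom (F t) = m' & cod (F t) = n']) ->
  typed m n c -> typed m' n' [seq (p.1, F p.2) | p <- c].
Proof.
move=> H; rewrite /typed all_map; apply: sub_all => p /= /and3P[w /eqP d /eqP e].
by have [-> -> ->] := H _ w d e; rewrite !eqxx.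
Qed.

(** Applying [G] to the outputs only merges fibres that already sum to zero. *)
Lemma polyId_map m n g (G : seq W -> seq W) (c : seq (k * Tm)) h :
  size g = m -> all reducedb g -> typed m n c -> polyId m n c ->
  \sum_(p <- c | G (evalG p.2 g) == h) p.1 = 0.
Proof.
move=> sg rg tc pc.
have := sum_fibers0 (s := [seq (p.1, evalG p.2 g) | p <- c]) (fun x => G x == h).
by rewrite big_map; apply=> i; rewrite big_map; apply: pc.
Qed.

Lemma Ideal_sound m n c : Ideal (k := k) m n c -> typed m n c /\ polyId m n c.
Proof.
elim=> {m n c}.
- exact: StructAx_sound.
- exact: VCocHopf_sound.
- by move=> m n; split=> // g _ _ h; rewrite big_nil.
- move=> m n c c' _ [t p] _ [t' p']; split; first by rewrite /typed all_cat; apply/andP.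
  by move=> g sg rg h; rewrite big_cat /= p // p' // addr0.
- move=> m n a c _ [t p]; split; first by rewrite /typed all_map.
  by move=> g sg rg h; rewrite big_map -mulr_sumr p // mulr0.
- move=> m n c c' _ [t p] t' e; split=> // g sg rg h.
  by rewrite -(sum_eq_coef (fun t => evalG t g == h) e) p.
- move=> m n t c wt_t dt _ [tc pc]; split.
    by apply: typed_map tc => s ws ds cs /=; rewrite wt_t ws cs dt eqxx.
  by move=> g sg rg h; rewrite big_map /=; apply: polyId_map tc pc.
- move=> m n t c wt_t ct _ [tc pc]; split.
    by apply: (typed_map (F := TComp ^~ t)) tc => s ws ds cs /=; rewrite wt_t ws ds ct eqxx.
  move=> g sg rg h; rewrite big_map /=; apply: pc; first by rewrite size_evalG.
  by apply: all_evalG => // [u v _|u]; [apply: reduced_mul|apply: reduced_inv].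
- move=> m n t c wt_t _ [tc pc]; split.
    by apply: typed_map tc => s ws ds cs /=; rewrite wt_t ws ds cs.
  move=> g sg rg h; rewrite big_map /=.
  apply: (polyId_map (fun x => evalG t (take (dom t) g) ++ x) h _ _ tc pc).
    by rewrite size_drop sg addKn.
  by move: rg; rewrite -{1}(cat_take_drop (dom t) g) all_cat => /andP[].
- move=> m n t c wt_t _ [tc pc]; split.
    by apply: (typed_map (F := TTens ^~ t)) tc => s ws ds cs /=; rewrite wt_t ws ds cs.
  move=> g sg rg h; rewrite big_map /=.
  rewrite -[RHS](polyId_map (g := take m g) (fun x => x ++ evalG t (drop m g)) h _ _ tc pc).
  (* [evalG] cuts the tuple at [dom p.2], which varies with p; typing fixes it to m. *)
  + rewrite big_seq_cond [RHS]big_seq_cond; apply: eq_bigl => p.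
    by apply: andb_id2l => pc'; have /and3P[_ /eqP-> _] := allP tc p pc'.
  + by rewrite size_takel // sg leq_addr.
  by move: rg; rewrite -{1}(cat_take_drop m g) all_cat => /andP[].
Qed.
End Soundness.

(** * Evaluating phi *)

Lemma wt_tensL (ts : seq Tm) : wt (tensL ts) = all wt ts.
Proof. by elim: ts => //= t ts ->. Qed.

Lemma dom_tensL (ts : seq Tm) : dom (tensL ts) = sumn (map dom ts).
Proof. by elim: ts => //= t ts ->. Qed.

Lemma cod_tensL (ts : seq Tm) : cod (tensL ts) = sumn (map cod ts).
Proof. by elim: ts => //= t ts ->. Qed.

Lemma evalG_tensL (T : eqType) (s : seq T) (F : T -> Tm) (G : T -> seq W) :
  {in s, forall x, size (G x) = dom (F x)} ->
  evalG (tensL (map F s)) (flatten (map G s)) = flatten [seq evalG (F x) (G x) | x <- s].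
Proof.
elim: s => [|x s IH] //= H; have sx := H x (mem_head _ _).
rewrite take_size_cat // drop_size_cat // IH // => y ys.
by apply: H; rewrite inE ys orbT.
Qed.

Lemma comulSS p : comul p.+2 = if p is q.+1 then TComp (TTens De (TId q.+1)) (comul p.+1) else De.
Proof. by case: p. Qed.

Lemma comul_typed p : [/\ wt (comul p), dom (comul p) = 1%N & cod (comul p) = p].
Proof.
elim: p => // -[|[|q]] // [w d c]; rewrite comulSS; split=> //.
by rewrite [wt _]/= -/(comul q.+2) w c eqxx.
Qed.

Lemma evalG_comul p w : evalG (comul p) [:: w] = nseq p w.
Proof.
elim: p => // -[|[|q]] // IH; rewrite comulSS.
by rewrite evalG_comp IH.
Qed.

Lemma multSS l : mult l.+2 = TComp mu (TTens (mult l.+1) (TId 1)).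
Proof. by []. Qed.

Lemma mult_typed l : [/\ wt (mult l), dom (mult l) = l & cod (mult l) = 1%N].
Proof.
elim: l => // -[|l] // [w d c]; rewrite multSS; split=> //.
  by rewrite [wt _]/= -/(mult l.+1) w c.
by rewrite [dom _]/= -/(mult l.+1) d addn1.
Qed.

(** Induction from the right, since [mult] is bracketed to the left; reducedness makes each product
    a concatenation. *)
Lemma evalG_mult w : reducedb w -> evalG (mult (size w)) [seq [:: a] | a <- w] = [:: w].
Proof.
elim/last_ind: w => // w a IH rw.
have [_ d _] := mult_typed (size w).
have rw' : reducedb w by move: rw; rewrite !reducedbE -cats1 => /cat_sorted2[].
case: w d rw' IH rw => [|b w] // d rw' IH rw.
rewrite size_rcons map_rcons [size _]/= multSS evalG_comp -cats1 evalG_cat; last by rewrite size_map d.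
by rewrite IH // -[LHS]/[:: mulF (b :: w) [:: a]] mulF_cat ?cats1.
Qed.

(** * Permutations realized by braidings *)

Definition is_perm N s := [&& size s == N, all (gtn N) s & uniq s].

(** The renumbering is the one in the recursive call of [permtm]: once source x is used up, later
    sources move down by one. *)
Lemma is_perm_behead N x s : is_perm N.+1 (x :: s) ->
  is_perm N [seq (if (x < i)%N then i.-1 else i) | i <- s].
Proof.
case/and3P=> /= /eqP[sz] /andP[xN sN] /andP[xs us].
have nx i : i \in s -> i != x by move=> si; apply: contraNneq xs => <-.
apply/and3P; split; first by rewrite size_map sz.
  rewrite all_map; apply/allP => i si /=; have := nx i si; have := allP sN i si => /=.
  by case: (ltnP x i); lia.
rewrite map_inj_in_uniq // => i j si sj; have := nx i si; have := nx j sj.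
by case: (ltnP x i); case: (ltnP x j); lia.
Qed.

Lemma permtm_typed N s : is_perm N s ->
  [/\ wt (permtm N s), dom (permtm N s) = N & cod (permtm N s) = N].
Proof.
elim: N s => [|N IH] [|x s] // p; have [w d c] := IH _ (is_perm_behead p).
case/and3P: p => /= /eqP[sz] /andP[xN sN] _.
rewrite w d c sz; by split; lia.
Qed.

Lemma evalG_permtm N s g : is_perm N s -> size g = N ->
  evalG (permtm N s) g = [seq nth [::] g i | i <- s].
Proof.
elim: N s g => [|N IH] [|x s] g // p sg; first by case: g sg.
have p' := is_perm_behead p; have [_ d _] := permtm_typed p'.
case/and3P: p => /= /eqP[sz] /andP[xN sN] /andP[xs us].
(* The braiding brings wire x to the front and keeps the order of the others. *)
have e : evalG (TTens (TBr x 1) (TId (size s - x))) g =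
    nth [::] g x :: take x g ++ drop x.+1 g.
  rewrite /= -catA; have -> : (x + 1)%N = x.+1 by rewrite addn1.
  rewrite take_takel // (take_nth [::]) ?sg // -cats1 drop_size_cat //.
  by rewrite size_takel // sg ltnW.
rewrite -[LHS]/(evalG (TTens (TId 1) (permtm N [seq (if (x < i)%N then i.-1 else i) | i <- s]))
  (evalG (TTens (TBr x 1) (TId (size s - x))) g)) e.
rewrite /= drop0 IH //; last by rewrite size_cat size_takel ?size_drop sg; lia.
rewrite -map_comp take0; congr (_ :: _); apply/eq_in_map => i si /=.
have ix : i != x by apply: contraNneq xs => <-.
have iN := allP sN i si.
rewrite nth_cat size_takel; last by rewrite sg ltnW.
(* Wires behind x sit one place earlier in the remaining list, hence [i.-1]. *)
case: (ltnP x i) => xi.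
  have -> : (i.-1 < x)%N = false by lia.
  by rewrite nth_drop; congr nth; lia.
have -> : (i < x)%N by lia.
by rewrite nth_take //; lia.
Qed.

(* The outputs of the comultiplications list the letters of [js] in increasing order;
   [rank t] is the place in that list of the copy used by the letter at [t]. *)
Section Sorting.
Variable js : seq nat.
Definition rank t := (count (fun i => i < nth 0 js t)%N js + count_mem (nth 0 js t) (take t js))%N.

Lemma count_ltS j : count (fun i => i < j.+1)%N js = (count (fun i => i < j)%N js + count_mem j js)%N.
Proof. by elim: js => //= i s ->; case: ltngtP; lia. Qed.

(** The block of copies of j starts right after all smaller letters. *)
Lemma nth_sorted (T : Type) (x0 : T) (h : nat -> T) m j r : (j < m)%N -> (r < count_mem j js)%N ->
  nth x0 (flatten [seq nseq (count_mem i js) (h i) | i <- iota 0 m]) (count (fun i => i < j)%N js + r) = h j.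
Proof.
have sz m' : size (flatten [seq nseq (count_mem i js) (h i) | i <- iota 0 m']) = count (fun i => i < m')%N js.
  elim: m' => [|m' IH]; first by rewrite (eq_count (a2 := pred0)) ?count_pred0.
  by rewrite -addn1 iotaD map_cat flatten_cat size_cat IH /= cats0 size_nseq addn1 count_ltS.
elim: m => // m IH; rewrite ltnS leq_eqVlt => /orP[/eqP->|jm] r_lt.
  rewrite -addn1 iotaD map_cat flatten_cat nth_cat sz ltnNge leq_addr /= cats0 addKn.
  by rewrite nth_nseq r_lt.
rewrite -addn1 iotaD map_cat flatten_cat nth_cat sz IH //; case: ifP => // /negbT.
have : (count (fun i => i < j.+1) js <= count (fun i => i < m) js)%N.
  by apply: sub_count => i /=; lia.
by rewrite count_ltS; lia.
Qed.

(** The inequality is strict because position t lies in the longer prefix but not in the shorter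
    one. *)
Lemma count_mem_take t u : (t < u)%N -> (t < size js)%N ->
  (count_mem (nth 0 js t) (take t js) < count_mem (nth 0 js t) (take u js))%N.
Proof.
move=> tu ts; have -> : take u js = take t js ++ drop t (take u js).
  by rewrite -{1}(cat_take_drop t (take u js)) take_takel // ltnW.
rewrite count_cat -addn1 leq_add2l -has_count; apply/hasP; exists (nth 0 js t) => //=.
have -> : nth 0 js t = nth 0 (drop t (take u js)) 0 by rewrite nth_drop addn0 nth_take.
by apply: mem_nth; rewrite size_drop size_take; case: (ltnP u (size js)) => ?; rewrite subn_gt0 ?tu ?ts.
Qed.

Lemma count_mem_take_lt t : (t < size js)%N ->
  (count_mem (nth 0 js t) (take t js) < count_mem (nth 0 js t) js)%N.
Proof. by move=> ts; have := count_mem_take ts ts; rewrite take_size. Qed.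

Lemma rank_lt t : (t < size js)%N -> (rank t < size js)%N.
Proof.
move=> ts; have := count_mem_take_lt ts.
have := count_size (fun i => i < (nth 0 js t).+1)%N js; rewrite count_ltS /rank; lia.
Qed.

(** The sorted list recovers the letter from its rank; the number of earlier occurrences then
    determines the position. *)
Lemma rank_inj : {in gtn (size js) &, injective rank}.
Proof.
move=> t u ts us e.
have nt v : (v < size js)%N -> nth 0 js v =
    nth 0 (flatten [seq nseq (count_mem i js) i | i <- iota 0 (sumn js).+1]) (rank v).
  move=> vs; rewrite (nth_sorted 0 id) ?count_mem_take_lt //.
  (* Each entry is at most the sum of all, so [(sumn js).+1] blocks include its own. *)
  by rewrite ltnS sumnE (big_nth 0) big_mkord (bigD1 (Ordinal vs)) //= leq_addr.
have ej : nth 0 js t = nth 0 js u by rewrite nt // e -nt.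
have [tu|ut|//] := ltngtP t u.
  by have := count_mem_take tu ts; move: e; rewrite /rank ej => /addnI ->; rewrite ltnn.
by have := count_mem_take ut us; move: e; rewrite /rank ej => /addnI ->; rewrite ltnn.
Qed.
End Sorting.

(** * Typing of phi and its value at the generators *)

Definition bounded m (w : W) := all (fun a => a.1 < m)%N w.

Lemma flatten_map1 (T U : Type) (f : T -> U) s : flatten [seq [:: f x] | x <- s] = map f s.
Proof. by elim: s => //= x s ->. Qed.

Lemma is_perm_rank js : is_perm (size js) [seq rank js t | t <- iota 0 (size js)].
Proof.
apply/and3P; split; first by rewrite size_map size_iota.
  by rewrite all_map; apply/allP => t; rewrite mem_iota => /= ts; apply: rank_lt.
rewrite map_inj_in_uniq ?iota_uniq // => t u; rewrite !mem_iota.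
exact: rank_inj.
Qed.

Section Phi.
Variables (m : nat) (ws : seq W).
Hypothesis ws_bounded : all (bounded m) ws.
Let occ := flatten ws.
Let js := map fst occ.
Let cnt j := count_mem j js.

Definition phiD := tensL [seq comul (cnt j) | j <- iota 0 m].
Definition phiP := permtm (size js) [seq rank js t | t <- iota 0 (size js)].
Definition phiF (w : W) := TComp (mult (size w)) (tensL [seq (if a.2 then An else TId 1) | a <- w]).

(** Passing to the list [js] of unsigned letters turns the wire sources of [phi_tm] into [rank]. *)
Lemma phi_tmE : phi_tm m ws = TComp (tensL (map phiF ws)) (TComp phiP phiD).
Proof.
rewrite /phi_tm /phiP /phiD /js size_map; congr (TComp _ (TComp (permtm _ _) (tensL _))).
  apply/eq_in_map => t; rewrite mem_iota => /= ts.
  by rewrite /rank (nth_map (0, false)%N) // -map_take !count_map.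
by apply: eq_map => j; rewrite /cnt count_map.
Qed.

Lemma occ_bounded : all (gtn m) js.
Proof.
rewrite all_map /occ; elim: (ws) ws_bounded => //= w vs IH /andP[bw /IH bvs].
by rewrite all_cat bvs andbT.
Qed.

Lemma phiF_typed w : [/\ wt (phiF w), dom (phiF w) = size w & cod (phiF w) = 1%N].
Proof.
have [mw md mc] := mult_typed (size w).
rewrite /= mw md mc wt_tensL dom_tensL cod_tensL -!map_comp all_map.
have -> : all (preim (fun a : nat * bool => if a.2 then An else TId 1) wt) w.
  by apply/allP => -[j []].
have e (f : Tm -> nat) : f An = 1%N -> f (TId 1) = 1%N ->
    sumn [seq (f \o (fun a : nat * bool => if a.2 then An else TId 1)) a | a <- w] = size w.
  by move=> f1 f2; elim: (w) => //= -[j []] v ->; rewrite ?f1 ?f2.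
by rewrite !e ?eqxx.
Qed.

(** The wires carry unsigned letters; the antipodes restore the signs before multiplication. *)
Lemma evalG_phiF w : reducedb w -> evalG (phiF w) [seq [:: (a.1, false)] | a <- w] = [:: w].
Proof.
move=> rw; rewrite /phiF evalG_comp -(flatten_map1 (fun a => [:: (a.1, false)])) evalG_tensL.
  rewrite -[RHS]evalG_mult // -(flatten_map1 (fun a => [:: a])).
  by congr (evalG _ (flatten _)); apply: eq_map => -[j []].
by move=> [j []].
Qed.

Lemma phiD_typed : [/\ wt phiD, dom phiD = m & cod phiD = size js].
Proof.
rewrite /phiD wt_tensL dom_tensL cod_tensL -!map_comp all_map; split.
- by apply/allP => j _ /=; case: (comul_typed (cnt j)).
- rewrite (eq_map (g := fun=> 1%N)) => [|j /=]; last by case: (comul_typed (cnt j)).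
  by rewrite -[RHS](size_iota 0 m); elim: iota => //= i s ->.
rewrite (eq_map (g := cnt)) => [|j /=]; last by case: (comul_typed (cnt j)).
transitivity (count (fun i => i < m)%N js); last by apply/eqP; rewrite -all_count occ_bounded.
elim: (m) => [|n IH]; first by rewrite (eq_count (a2 := pred0)) ?count_pred0.
by rewrite -addn1 iotaD map_cat sumn_cat IH /= addn0 addn1 count_ltS.
Qed.

Lemma evalG_phiD :
  evalG phiD (gens m) = flatten [seq nseq (cnt j) [:: (j, false)] | j <- iota 0 m].
Proof.
rewrite /gens -(flatten_map1 (fun j => [:: (j, false)])) evalG_tensL.
  by congr flatten; apply: eq_map => j; rewrite evalG_comul.
by move=> j _; case: (comul_typed (cnt j)) => _ ->.
Qed.

Lemma size_gens : size (gens m) = m.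
Proof. by rewrite size_map size_iota. Qed.

Lemma evalG_phiP :
  evalG phiP (evalG phiD (gens m)) = [seq [:: (a.1, false)] | a <- occ].
Proof.
have [w d c] := phiD_typed.
rewrite evalG_permtm ?is_perm_rank ?size_evalG ?size_gens // evalG_phiD -map_comp.
rewrite -[RHS](mkseq_nth [::]) /mkseq !size_map; apply/eq_in_map => t; rewrite mem_iota => /= ts.
have tj : (t < size js)%N by rewrite size_map.
rewrite (nth_map (0, false)%N) // (nth_sorted _ (fun j => [:: (j, false)])).
- by rewrite (nth_map (0, false)%N).
- exact: (all_nthP 0 occ_bounded).
exact: count_mem_take_lt.
Qed.

Lemma phi_tm_typed : [/\ wt (phi_tm m ws), dom (phi_tm m ws) = m & cod (phi_tm m ws) = size ws].
Proof.
have [w d c] := phiD_typed; have [w' d' c'] := permtm_typed (is_perm_rank js).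
rewrite phi_tmE /= wt_tensL dom_tensL cod_tensL all_map w w' d d' c c' eqxx -!map_comp.
have -> : all (preim phiF wt) ws by apply/allP => v _; case: (phiF_typed v).
rewrite (eq_map (g := size)) => [|v]; last by case: (phiF_typed v).
rewrite (eq_map (f := cod \o phiF) (g := fun=> 1%N)) => [|v]; last by case: (phiF_typed v).
by rewrite /js size_map size_flatten eqxx; split=> //; elim: (ws) => //= v vs ->.
Qed.

Lemma evalG_phi : all reducedb ws -> evalG (phi_tm m ws) (gens m) = ws.
Proof.
move=> rws; rewrite phi_tmE !evalG_comp evalG_phiP map_flatten evalG_tensL.
  rewrite -[RHS]map_id -[RHS](flatten_map1 id); congr flatten; apply/eq_in_map => w ww.
  by rewrite evalG_phiF // (allP rws).
by move=> w _; rewrite size_map; case: (phiF_typed w).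
Qed.
End Phi.

(** * Normal forms of terms and of linear combinations *)

Definition basis_word m (w : W) := reducedb w && bounded m w.

Lemma bounded_push m a w : (a.1 < m)%N -> bounded m w -> bounded m (pushF a w).
Proof. by case: w => [|b w] am /=; [rewrite am|case: ifP => _ /andP[bm wm] //=; rewrite am bm]. Qed.

Lemma bounded_mul m u v : bounded m u -> bounded m v -> bounded m (mulF u v).
Proof. by move=> + bv; elim: u => //= a u IH /andP[am /IH]; apply: bounded_push. Qed.

Lemma bounded_inv m w : bounded m w -> bounded m (invF w).
Proof. by rewrite /invF /bounded all_rev all_map. Qed.

Lemma reduced_gens m : all reducedb (gens m).
Proof. by rewrite all_map; apply/allP. Qed.

Lemma basisF_evalG m n t : wt t -> dom t = m -> cod t = n -> basisF m n (evalG t (gens m)).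
Proof.
move=> w d c; rewrite /basisF size_evalG ?size_gens // c eqxx /=.
apply: (@all_evalG (basis_word m)) => // [u v /andP[ru bu] /andP[rv bv]|u /andP[ru bu]|].
- by rewrite /basis_word reduced_mul // bounded_mul.
- by rewrite /basis_word reduced_inv // bounded_inv.
by rewrite all_map; apply/allP => j; rewrite mem_iota /basis_word /= andbT.
Qed.

Lemma basisFP m n ws : basisF m n ws -> [/\ size ws = n, all reducedb ws & all (bounded m) ws].
Proof.
case/andP=> /eqP->; rewrite -[all _ ws]/(all (predI reducedb (bounded m)) ws).
by rewrite all_predI => /andP[].
Qed.

Section Linear.
Variable k : fieldType.

Lemma typed_phiC m n (a : seq (k * seq W)) : validF m n a -> typed m n (phiC m a).
Proof.
rewrite /validF /typed all_map; apply: sub_all => p /basisFP[<- _ b].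
by have [w d e] := phi_tm_typed b; apply/and3P; split=> //; apply/eqP.
Qed.

Lemma eqv_phi m n t : wt t -> dom t = m -> cod t = n ->
  eqv k (phi_tm m (evalG t (gens m))) t.
Proof.
move=> w d c; have [_ r b] := basisFP (basisF_evalG w d c).
have [w' d' _] := phi_tm_typed b.
by apply: eqv_evalG => //; rewrite d' ?evalG_phi.
Qed.

Lemma Ideal_map_eqv m n (F : Tm -> Tm) (c : seq (k * Tm)) : typed m n c ->
  (forall t, wt t -> dom t = m -> cod t = n -> eqv k (F t) t) ->
  Ideal m n ([seq (p.1, F p.2) | p <- c] ++ scale (-1) c).
Proof.
move=> + H; elim: c => [|[x t] c IH] /=; first by move=> _; apply: i_nil.
case/andP=> /= /and3P[w /eqP d /eqP e] tc.
have [w' d' e' I] := H t w d e; rewrite w' d' e' d e in I.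
apply: (i_coef (i_add (i_scale x (I w)) (IH tc))).
  rewrite /typed /= all_cat /= w' d' e' w d e !eqxx /=.
  have tc' : typed m n [seq (p.1, F p.2) | p <- c].
    by apply: (typed_map (F := F) _ tc) => s ws ds es; have [-> -> -> _] := H s ws ds es.
  apply/andP; split; first exact: tc'.
  by rewrite all_map; exact: tc.
move=> s; rewrite coef_cat coef_scale coef_rel.
rewrite coef_cons !coef_cat coef_cons /=.
by case: (Tm_eq_dec t s) => ?; case: (Tm_eq_dec (F t) s) => ? /=; ring.
Qed.

Lemma Ideal_coef0 m n (c : seq (k * Tm)) : typed m n c -> (forall t, coef c t = 0) -> Ideal m n c.
Proof. by move=> tc c0; apply: (i_coef (i_nil k m n)) => // t; rewrite coef_nil c0. Qed.

End Linear.

(** * Bijectivity of phi and the identities of the free group algebra *)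

Theorem mainTheorem8 (k : fieldType) :
  (forall m n : nat,
     (forall a : seq (k * seq W), validF m n a -> typed m n (phiC m a))
  /\ (forall c : seq (k * Tm), typed m n c ->
        exists a : seq (k * seq W), validF m n a /\ Ideal m n (phiC m a ++ scale (-1) c))
  /\ (forall a : seq (k * seq W), validF m n a -> Ideal m n (phiC m a) ->
        forall ws : seq W, coefF a ws = 0))
  /\ (forall (m n : nat) (v : seq (k * Tm)), VCocHopf m n v -> polyId m n v)
  /\ (forall (m n : nat) (c : seq (k * Tm)), typed m n c -> polyId m n c -> Ideal m n c).
Proof.
(* Evaluating c at the generators gives an explicit preimage, used both for surjectivity and for the
   last claim. *)
have normal m n (c : seq (k * Tm)) : typed m n c ->
    let a := [seq (p.1, evalG p.2 (gens m)) | p <- c] in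
    validF m n a /\ Ideal m n (phiC m a ++ scale (-1) c).
  move=> tc a; split.
    rewrite /validF all_map; apply: sub_all tc => p /= /and3P[w /eqP d /eqP e].
    exact: basisF_evalG.
  have -> : phiC m a = [seq (p.1, phi_tm m (evalG p.2 (gens m))) | p <- c].
    by rewrite /phiC -map_comp.
  by apply: (Ideal_map_eqv (F := fun t => phi_tm m (evalG t (gens m)))) => // t; apply: eqv_phi.
split; last split.
- move=> m n; split; [exact: typed_phiC|split].
    by move=> c /normal H; eexists; exact: H.
  move=> a va /Ideal_sound[_ /(_ (gens m) (size_gens m) (reduced_gens m)) pa] ws.
  (* At the generators each term of [phiC m a] evaluates back to its tuple, so soundness there reads
     off the coefficients of a. *)
  rewrite -[RHS](pa ws) /coefF big_map big_seq_cond [RHS]big_seq_cond.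
  apply: eq_bigl => p; apply: andb_id2l => pa'.
  by have [_ r b] := basisFP (allP va p pa'); rewrite evalG_phi.
- by move=> m n v /VCocHopf_sound[].
move=> m n c tc pc; have [va I] := normal m n c tc.
set a := [seq _ | _ <- _] in va I.
(* The identity at the generators kills every coefficient of a, hence every coefficient of its
   image. *)
have a0 : Ideal m n (phiC m a).
  apply: Ideal_coef0 => [|t]; first exact: typed_phiC.
  rewrite coefE big_map; apply: (sum_fibers0 (fun ws => phi_tm m ws == t)) => ws.
  by rewrite big_map; apply: pc; [exact: size_gens|exact: reduced_gens].
(* Here c is written as phi(a) - (phi(a) - c). *)
apply: (i_coef (i_add a0 (i_scale (-1) I))) => // t.
by rewrite !(coef_cat, coef_scale) mulrDr !mulN1r opprK addrA subrr add0r.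
Qed.
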